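(* For any $\epsilon>0$ there exists a $\delta>0$ satisfying the following condition: Let $A=M_N$ for some $N\in\mathbf{N}$, $B$ a unital $*$-subalgebra of $A$ with $B\cong M_K$ for some $K$ dividing $N$, and $H\in A_{sa}$ such that $$e^{itH}Be^{-itH}\stackrel{\delta}{\subset}B$$ for $t\in[0,1]$. Then there exist a $u\in\mathcal{U}(A)$ and $h\in A_{sa}$ such that $\|u-1\|<\epsilon$, $\|h\|<\epsilon$, and $$u^*e^{it(H+h)}uBu^*e^{-it(H+h)}u=B,\quad t\in\mathbf{R}.$$
   Context: $M_N$ is the C$^*$-algebra of complex $N\times N$ matrices. $A_{sa}$ is the set of self-adjoint elements of $A$ and $\mathcal{U}(A)$ its unitary group. For C$^*$-subalgebras $B,C$ of $A$ and $\delta>0$, $B\stackrel{\delta}{\subset}C$ means that for any $x\in B$ there is $y\in C$ with $\|x-y\|\le\delta\|x\|$. *)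

(* Defs.v *)
From HB Require Import structures.
From mathcomp Require Export all_boot all_order all_algebra.
From mathcomp Require Export complex.
From mathcomp Require Export all_classical all_reals all_analysis.
Export Order.TTheory GRing.Theory Num.Theory.
Export numFieldNormedType.Exports.

Set Implicit Arguments.
Unset Strict Implicit.
Unset Printing Implicit Defensive.

Local Open Scope classical_set_scope.
Local Open Scope sesquilinear_scope.
Local Open Scope complex_scope.
Local Open Scope ring_scope.

Section Matrices.
Variables (R : realType) (N : nat).
Local Notation C := R[i].
Implicit Types (x u a b : 'M[C]_N) (B S T : set 'M[C]_N).

Definition l2norm (v : 'cV[C]_N) : R :=
  Num.sqrt (\sum_(i < N) Normc.normc (v i 0) ^+ 2).

Definition opnorm x : R :=
  sup [set l2norm (x *m v) | v in [set v : 'cV[C]_N | l2norm v <= 1]].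

(* [R[i]^o] carries the norm topology of [R[i]], so that matrices over it form a
   normed module in which the exponential series converges. *)
Definition expmx x : 'M[C]_N :=
  lim ([series (k`!%:R)^-1 *: x ^+ k : 'M[C^o]_N]_k @ \oo).

Definition unital_star_subalgebra B : Prop :=
  [/\ B 1%:M,
      forall a b, B a -> B b -> B (a + b),
      forall (c : C) a, B a -> B (c *: a),
      forall a b, B a -> B b -> B (a *m b)
    & forall a, B a -> B (a ^t*)].

(* On a finite-dimensional C*-algebra every *-algebra isomorphism is isometric,
   so no norm condition is imposed on [phi]. *)
Definition star_isomorphic_to_mx (K : nat) B : Prop :=
  exists phi : 'M[C]_K -> 'M[C]_N,
    [/\ linear phi,
        {morph phi : a b / a *m b},
        {morph phi : a / a ^t*}
      & set_bij [set: 'M[C]_K] B phi].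

Definition near_subset (delta : R) S T : Prop :=
  forall x, S x -> exists2 y, T y & opnorm (x - y) <= delta * opnorm x.

Definition sandwich a B b : set 'M[C]_N := [set a *m x *m b | x in B].

End Matrices.

(* Main.v *)
From HB Require Import structures.
Require Import Defs.
From mathcomp Require Import ring lra.

(** Let [e] be matrix units of [B] and let [E] be the trace-preserving conditional
    expectation onto [B].  With [V = exp(iH/n)], put [T = 1/n \sum_(1 <= k <= n) Ad(V^k) E Ad(V^-k)].
    Each summand is the expectation onto an algebra near [B], so [T] is near [E]; the sum
    telescopes, so [Ad(V^-1) T Ad(V) - T] is of size [delta / n].
    For an algebra [q] near [B], the "defect" of [T] at [q] is a matrix orthogonal to
    [q + q'] that measures, to first order, how far [q] has to be rotated to become the centre
    of mass of the algebras entering [T].  It is equivariant under unitaries; hence Newton's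
    iteration, with Cayley transforms as the rotations, produces [q = u B u^*] with [u] near [1]
    and a defect as small as we please.  Comparing the defect of [T] with that of
    [Ad(V^-1) T Ad(V)] then bounds the component of [iH/n] orthogonal to [q + q'] by a
    multiple of [delta / n], with a constant that depends neither on [N] nor on [H].
    Removing that component from [H] leaves a generator in [q + q'], which preserves [q]. *)

(** The hypothesis concerns the times in [0,1] only and gives no bound on [H], while the constants
    may depend neither on [N] nor on [opnorm H]. Cutting [0,1] into n steps makes Ad(V) a small
    perturbation of the identity, so first-order expansions are legitimate once n is large in terms
    of [H]. The invariance error delta / n and the generator iH/n scale alike, so n drops out at the
    end. The obstacle is the part of iH/n inside q + q': it acts on the defect by a commutator, of
    size opnorm H / n times the defect, and opnorm H is uncontrolled. One correction of q is
    therefore not enough; the defect has to be small compared with delta / opnorm H. The Newton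
    steps decrease geometrically, so the total displacement of q stays of order delta however many
    of them [H] requires. Independence of [N] and [K] comes from two facts: the Casimir sums are
    means over unitaries, and the expectation is a compression. Both are contractive. *)

Set Implicit Arguments.
Unset Strict Implicit.
Unset Printing Implicit Defensive.

Local Open Scope classical_set_scope.
Local Open Scope sesquilinear_scope.
Local Open Scope complex_scope.
Local Open Scope ring_scope.

(** * The operator norm *)

Section OperatorNorm.
Variables (R : realType) (N : nat).
Local Notation C := R[i].
Local Notation normc := Normc.normc.
Implicit Types (v w : 'cV[C]_N) (x y a b : 'M[C]_N).

Definition dotc v w : C := (v^t* *m w) 0 0.

Lemma dotcE v w : dotc v w = \sum_i (v i 0)^* * w i 0.
Proof. by rewrite /dotc mxE; apply: eq_bigr => i _; rewrite !mxE. Qed.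

Lemma dotcDl v1 v2 w : dotc (v1 + v2) w = dotc v1 w + dotc v2 w.
Proof. by rewrite /dotc raddfD /= map_mxD mulmxDl mxE. Qed.
Lemma dotcDr v w1 w2 : dotc v (w1 + w2) = dotc v w1 + dotc v w2.
Proof. by rewrite /dotc mulmxDr mxE. Qed.
Lemma dotcZr c v w : dotc v (c *: w) = c * dotc v w.
Proof. by rewrite /dotc -scalemxAr mxE. Qed.
Lemma dotcC v w : dotc w v = (dotc v w)^*.
Proof.
rewrite !dotcE rmorph_sum; apply: eq_bigr => i _ /=.
by rewrite rmorphM /= conjCK mulrC.
Qed.
Lemma dotcZl c v w : dotc (c *: v) w = c^* * dotc v w.
Proof. by rewrite dotcC dotcZr rmorphM /= -dotcC. Qed.
Lemma dotc_adj x v w : dotc v (x *m w) = dotc (x^t* *m v) w.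
Proof. by rewrite /dotc trmx_mul map_mxM /= trmxCK mulmxA. Qed.

Lemma l2norm_ge0 v : 0 <= l2norm v.
Proof. exact: sqrtr_ge0. Qed.

Lemma normcE (z : C) : `|z| = (normc z)%:C.
Proof. by []. Qed.

Lemma normc_ge0 (z : C) : 0 <= normc z.
Proof. by rewrite -ler0c -normcE. Qed.

Lemma sqr_l2norm v : l2norm v ^+ 2 = \sum_i normc (v i 0) ^+ 2.
Proof.
by rewrite sqr_sqrtr // sumr_ge0 // => i _; rewrite exprn_ge0 // normc_ge0.
Qed.

Lemma dotcvv v : dotc v v = (l2norm v ^+ 2)%:C.
Proof.
rewrite sqr_l2norm dotcE rmorph_sum; apply: eq_bigr => i _ /=.
by rewrite rmorphXn /= -normcE mulrC normCK.
Qed.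

Lemma Re_normc (z : C) : complex.Re z <= normc z.
Proof.
have := normc_ge_Re z; rewrite normcE lecR; apply: le_trans; exact: ler_norm.
Qed.

Lemma l2norm_eq0 v : l2norm v = 0 -> v = 0.
Proof.
move=> v0; have := sqr_l2norm v; rewrite v0 expr0n /= => /esym/eqP.
rewrite psumr_eq0 => [/allP s0|i _]; last by rewrite exprn_ge0 // normc_ge0.
apply/colP => i; rewrite mxE; apply: Normc.eq0_normc.
by apply/eqP; rewrite -sqrf_eq0; apply: s0; rewrite mem_index_enum.
Qed.

(** Weighted AM-GM term by term, from the square of [s * a - b]. The weight is chosen afterwards:
    [s = l2norm w / l2norm v] yields Cauchy-Schwarz. *)
Lemma normc_dot_amgm v w (s : R) : 0 < s ->
  normc (dotc v w) <= (s * l2norm v ^+ 2 + s^-1 * l2norm w ^+ 2) / 2.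
Proof.
move=> s0.
have H i : normc ((v i 0)^* * w i 0) <=
    (s * normc (v i 0) ^+ 2 + s^-1 * normc (w i 0) ^+ 2) / 2.
  rewrite Normc.normcM.
  have -> : normc ((v i 0)^*) = normc (v i 0).
    apply: complexI; rewrite -[LHS]normcE -[RHS]normcE.
    by rewrite norm_conjC.
  set a := normc _; set b := normc _.
  have : 0 <= s^-1 * (s * a - b) ^+ 2.
    by rewrite mulr_ge0 ?invr_ge0 ?(ltW s0)// sqr_ge0.
  have -> : s^-1 * (s * a - b) ^+ 2 = s * a ^+ 2 + s^-1 * b ^+ 2 - 2 * (a * b).
    by field; rewrite gt_eqF.
  lra.
rewrite dotcE !sqr_l2norm !mulr_sumr -big_split /= mulr_suml.
rewrite -lecR -normcE rmorph_sum /=; apply: le_trans (ler_norm_sum _ _ _) _.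
by apply: ler_sum => i _; rewrite normcE lecR.
Qed.

Lemma cauchy_schwarz v w : normc (dotc v w) <= l2norm v * l2norm w.
Proof.
have [/l2norm_eq0 -> |v0] := eqVneq (l2norm v) 0.
  rewrite /dotc trmx0 map_mx0 mul0mx mxE Normc.normc0.
  by rewrite mulr_ge0 // l2norm_ge0.
have [/l2norm_eq0 -> |w0] := eqVneq (l2norm w) 0.
  by rewrite /dotc mulmx0 mxE Normc.normc0 mulr_ge0 // l2norm_ge0.
have vp : 0 < l2norm v by rewrite lt_def v0 l2norm_ge0.
have wp : 0 < l2norm w by rewrite lt_def w0 l2norm_ge0.
have := @normc_dot_amgm v w (l2norm w / l2norm v) (divr_gt0 wp vp).
have -> // : (l2norm w / l2norm v * l2norm v ^+ 2 +
  (l2norm w / l2norm v)^-1 * l2norm w ^+ 2) / 2 = l2norm v * l2norm w.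
by field; rewrite v0 w0.
Qed.

Lemma l2normZ (c : C) v : l2norm (c *: v) = normc c * l2norm v.
Proof.
apply/eqP; rewrite -(@eqrXn2 _ 2) ?l2norm_ge0 ?mulr_ge0 ?normc_ge0 ?l2norm_ge0 //.
rewrite exprMn !sqr_l2norm mulr_sumr; apply/eqP/eq_bigr => i _.
by rewrite mxE Normc.normcM exprMn.
Qed.

Lemma l2normD v w : l2norm (v + w) <= l2norm v + l2norm w.
Proof.
rewrite -(@ler_pXn2r _ 2) ?nnegrE ?addr_ge0 ?l2norm_ge0 //.
have : dotc (v + w) (v + w) = (l2norm v ^+ 2)%:C + (l2norm w ^+ 2)%:C
    + (dotc v w + (dotc v w)^*).
  by rewrite dotcDl !dotcDr !dotcvv -dotcC; ring.
rewrite dotcvv => /(congr1 (@complex.Re R)).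
have -> : dotc v w + (dotc v w)^* = 2%:R * (complex.Re (dotc v w))%:C.
  by rewrite -addcJ.
set d := dotc v w; have := Re_normc d; have := cauchy_schwarz v w; rewrite -/d.
case: d => p q /=; rewrite sqrrD; lra.
Qed.

Lemma l2norm0 : l2norm (0 : 'cV[C]_N) = 0.
Proof. by rewrite -(scale0r 0) l2normZ Normc.normc0 mul0r. Qed.

Lemma l2norm_sum (I : finType) (f : I -> 'cV[C]_N) :
  l2norm (\sum_i f i) <= \sum_i l2norm (f i).
Proof.
elim/big_ind2: _ => [|v1 s1 v2 s2 h1 h2|//]; first by rewrite l2norm0.
exact: le_trans (l2normD _ _) (lerD h1 h2).
Qed.

(** A crude bound by the columns, dependent on [N]; its purpose is that the supremum defining
    [opnorm] is finite. *)
Lemma opnorm_bounded x : exists2 c : R, 0 <= c &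
  forall v, l2norm (x *m v) <= c * l2norm v.
Proof.
exists (\sum_j l2norm (col j x)) => [|v].
  by rewrite sumr_ge0 // => j _; rewrite l2norm_ge0.
have -> : x *m v = \sum_j v j 0 *: col j x.
  apply/colP => i; rewrite mxE summxE; apply: eq_bigr => j _.
  by rewrite !mxE mulrC.
apply: le_trans (l2norm_sum _) _; rewrite mulr_suml; apply: ler_sum => j _.
rewrite l2normZ mulrC ler_wpM2l ?l2norm_ge0 //.
rewrite -(@ler_pXn2r _ 2) ?nnegrE ?normc_ge0 ?l2norm_ge0 // sqr_l2norm.
rewrite (bigD1 j) //= lerDl sumr_ge0 // => k _.
by rewrite exprn_ge0 // normc_ge0.
Qed.

Let unit_image x := [set l2norm (x *m v) | v in [set v : 'cV[C]_N | l2norm v <= 1]].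

Lemma unit_image0 x : unit_image x 0.
Proof. by exists 0 => /=; rewrite ?mulmx0 l2norm0. Qed.

Lemma unit_image_sup x : has_sup (unit_image x).
Proof.
split; first by exists 0; exact: unit_image0.
have [c c0 h] := opnorm_bounded x; exists c => _ [v /= v1 <-].
apply: le_trans (h v) _; exact: ler_piMr.
Qed.

Lemma opnorm_ge0 x : 0 <= opnorm x.
Proof. apply: ub_le_sup (unit_image0 x); exact: (unit_image_sup x).2. Qed.

Lemma le_opnorm x v : l2norm (x *m v) <= opnorm x * l2norm v.
Proof.
have [/l2norm_eq0 -> |v0] := eqVneq (l2norm v) 0.
  by rewrite mulmx0 l2norm0 mulr0.
have vp : 0 < l2norm v by rewrite lt_def v0 l2norm_ge0.
rewrite -ler_pdivrMr //.
have nV : normc ((l2norm v)^-1)%:C = (l2norm v)^-1.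
  by apply: complexI; rewrite -normcE ger0_norm // ler0c invr_ge0 ltW.
have -> : l2norm (x *m v) / l2norm v = l2norm (x *m (((l2norm v)^-1)%:C *: v)).
  by rewrite -scalemxAr l2normZ nV mulrC.
apply: ub_le_sup; first exact: (unit_image_sup x).2.
by exists (((l2norm v)^-1)%:C *: v) => //=; rewrite l2normZ nV mulVf.
Qed.

Lemma opnorm_le x (c : R) : 0 <= c ->
  (forall v, l2norm (x *m v) <= c * l2norm v) -> opnorm x <= c.
Proof.
move=> c0 h; apply: ge_sup; first by exists 0; exact: unit_image0.
move=> _ [v /= v1 <-]; apply: le_trans (h v) _; exact: ler_piMr.
Qed.

Lemma opnorm0 : opnorm (0 : 'M[C]_N) = 0.
Proof.
apply/le_anti; rewrite opnorm_ge0 andbT; apply: opnorm_le => // v.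
by rewrite mul0mx l2norm0 mul0r.
Qed.

Lemma opnorm_eq0 x : opnorm x = 0 -> x = 0.
Proof.
move=> x0; apply/matrixP => i j; rewrite mxE.
have := le_opnorm x (delta_mx j 0); rewrite x0 mul0r => h.
have /l2norm_eq0/colP/(_ i) : l2norm (x *m delta_mx j 0) = 0.
  by apply/le_anti; rewrite h l2norm_ge0.
by rewrite -colE !mxE.
Qed.

Lemma opnormD x y : opnorm (x + y) <= opnorm x + opnorm y.
Proof.
apply: opnorm_le => [|v]; first by rewrite addr_ge0 // opnorm_ge0.
rewrite mulmxDl mulrDl; apply: le_trans (l2normD _ _) _.
by rewrite lerD // le_opnorm.
Qed.

Lemma opnormZ (c : C) x : opnorm (c *: x) <= normc c * opnorm x.
Proof.
apply: opnorm_le => [|v]; first by rewrite mulr_ge0 ?normc_ge0 ?opnorm_ge0.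
by rewrite -scalemxAl l2normZ -mulrA ler_wpM2l ?normc_ge0 // le_opnorm.
Qed.

Lemma opnormN x : opnorm (- x) = opnorm x.
Proof.
suff h y : opnorm (- y) <= opnorm y.
  by apply/le_anti; rewrite h /= -{1}(opprK x) h.
rewrite -scaleN1r; apply: le_trans (opnormZ _ _) _.
by rewrite normcN Normc.normc1 mul1r.
Qed.

Lemma opnormB x y : opnorm (x - y) <= opnorm x + opnorm y.
Proof. by rewrite -(opnormN y) opnormD. Qed.

Lemma opnorm_subC x y : opnorm (x - y) = opnorm (y - x).
Proof. by rewrite -opnormN opprB. Qed.

Lemma opnormM x y : opnorm (x *m y) <= opnorm x * opnorm y.
Proof.
apply: opnorm_le => [|v]; first by rewrite mulr_ge0 ?opnorm_ge0.
rewrite -mulmxA -mulrA; apply: le_trans (le_opnorm _ _) _.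
by rewrite ler_wpM2l ?opnorm_ge0 // le_opnorm.
Qed.

Lemma opnormM_le x y (p q : R) : opnorm x <= p -> opnorm y <= q ->
  opnorm (x *m y) <= p * q.
Proof.
by move=> xp yq; apply: le_trans (opnormM _ _) _; rewrite ler_pM ?opnorm_ge0.
Qed.

Lemma opnorm_sum (I : finType) (f : I -> 'M[C]_N) :
  opnorm (\sum_i f i) <= \sum_i opnorm (f i).
Proof.
elim/big_ind2: _ => [|v1 s1 v2 s2 h1 h2|//]; first by rewrite opnorm0.
exact: le_trans (opnormD _ _) (lerD h1 h2).
Qed.

(** Testing with [w = x *m v] and cancelling one factor [l2norm (x *m v)] recovers the bound on
    vectors. *)
Lemma opnorm_le_dot x (c : R) : 0 <= c ->
  (forall v w, normc (dotc w (x *m v)) <= c * (l2norm v * l2norm w)) ->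
  opnorm x <= c.
Proof.
move=> c0 h; apply: opnorm_le => // v.
have [-> |x0] := eqVneq (l2norm (x *m v)) 0.
  by rewrite mulr_ge0 ?l2norm_ge0.
have xp : 0 < l2norm (x *m v) by rewrite lt_def x0 l2norm_ge0.
rewrite -(ler_pM2r xp) -mulrA; apply: le_trans (h _ _).
by rewrite dotcvv -expr2 -lecR -normcE ger0_norm // ler0c exprn_ge0 // ltW.
Qed.

Lemma opnorm_adj x : opnorm (x^t*) <= opnorm x.
Proof.
apply: opnorm_le_dot; first exact: opnorm_ge0.
move=> v w; rewrite dotc_adj trmxCK; apply: le_trans (cauchy_schwarz _ _) _.
by rewrite mulrA [_ * l2norm w]mulrAC ler_wpM2r ?l2norm_ge0 // le_opnorm.
Qed.

Lemma unitarymx_adjK (u : 'M[C]_N) : u \is unitarymx -> u^t* *m u = 1%:M.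
Proof. by move=> hu; rewrite -invmx_unitary // mulVmx // unitarymx_unit. Qed.

Lemma l2norm_unitary (u : 'M[C]_N) v : u \is unitarymx -> l2norm (u *m v) = l2norm v.
Proof.
move=> hu; apply/eqP; rewrite -(@eqrXn2 _ 2) ?l2norm_ge0 //.
apply/eqP/complexI; rewrite -!dotcvv dotc_adj mulmxA unitarymx_adjK //.
by rewrite mul1mx.
Qed.

Lemma opnorm_unitary (u : 'M[C]_N) : u \is unitarymx -> opnorm u <= 1.
Proof.
by move=> hu; apply: opnorm_le => // v; rewrite l2norm_unitary // mul1r.
Qed.

End OperatorNorm.

(** * Matrix units and conditional expectations *)

Section MatrixUnits.
Variables (R : realType) (N K : nat).
Hypothesis N_gt0 : (0 < N)%N.
Local Notation C := R[i].
Implicit Types (e : 'I_K.+1 -> 'I_K.+1 -> 'M[C]_N) (x y b c : 'M[C]_N).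

Definition matrix_units e : Prop :=
  [/\ forall i j k l, e i j *m e k l = (j == k)%:R *: e i l,
      forall i j, (e i j)^t* = e j i
    & \sum_i e i i = 1%:M].

(* The trace-preserving conditional expectations onto the span of the [e i j]
   and onto its commutant. *)
Definition condexp e x : 'M[C]_N :=
  \sum_i \sum_j (K.+1%:R / N%:R * \tr (x *m e j i)) *: e i j.

Definition commexp e x : 'M[C]_N :=
  K.+1%:R^-1 *: \sum_i \sum_j e i j *m x *m e j i.

Definition inalg e x := condexp e x = x.
Definition incom e x := forall i j, x *m e i j = e i j *m x.

Lemma condexp_is_linear e : linear (condexp e).
Proof.
move=> a x y; rewrite /condexp scaler_sumr -big_split; apply: eq_bigr => i _ /=.
rewrite scaler_sumr -big_split; apply: eq_bigr => j _ /=.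
by rewrite mulmxDl -scalemxAl mxtraceD mxtraceZ scalerA -scalerDl; congr (_ *: _); ring.
Qed.
HB.instance Definition _ e :=
  GRing.isLinear.Build C 'M[C]_N 'M[C]_N _ (condexp e) (condexp_is_linear e).

Lemma commexp_is_linear e : linear (commexp e).
Proof.
move=> a x y; rewrite /commexp scalerA mulrC -scalerA -scalerDr; congr (_ *: _).
rewrite scaler_sumr -big_split; apply: eq_bigr => i _ /=.
rewrite scaler_sumr -big_split; apply: eq_bigr => j _ /=.
by rewrite mulmxDr mulmxDl -scalemxAr -scalemxAl.
Qed.
HB.instance Definition _ e :=
  GRing.isLinear.Build C 'M[C]_N 'M[C]_N _ (commexp e) (commexp_is_linear e).

Section Fixed.
Variable e : 'I_K.+1 -> 'I_K.+1 -> 'M[C]_N.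
Hypothesis eU : matrix_units e.

Let eM i j k l : e i j *m e k l = (j == k)%:R *: e i l.
Proof. by case: eU. Qed.
Let eA i j : (e i j)^t* = e j i.
Proof. by case: eU. Qed.
Let e1 : \sum_i e i i = 1%:M.
Proof. by case: eU. Qed.

Lemma inalg_ind (P : 'M[C]_N -> Prop) : P 0 ->
  (forall a x y, P x -> P y -> P (a *: x + y)) -> (forall i j, P (e i j)) ->
  forall x, inalg e x -> P x.
Proof.
move=> P0 PL Pe x <-.
have PD a y z : P y -> P z -> P (y + z).
  by move=> Py Pz; rewrite -(scale1r y); apply: PL.
rewrite /condexp; elim/big_ind: _ => [//|y z|i _]; first exact: PD.
elim/big_ind: _ => [//|y z|j _]; first exact: PD.
by rewrite -[X in P X]addr0; apply: PL.
Qed.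

(** Since [e k k = e k l *m e l k], cyclicity gives all diagonal units the same trace, and these
    traces add up to [N]. For [i != j] cyclicity applied to [e i i *m e i j] gives 0. *)
Lemma mxtrace_unit i j : \tr (e i j) = (i == j)%:R * (N%:R / K.+1%:R).
Proof.
have H k l : \tr (e k k) = \tr (e l l).
  have -> : e k k = e k l *m e l k by rewrite eM eqxx scale1r.
  by rewrite mxtrace_mulC eM eqxx scale1r.
have [->|nij] := eqVneq i j.
  have := congr1 mxtrace e1; rewrite mxtrace1 raddf_sum /=.
  under eq_bigr do rewrite (H _ j).
  rewrite sumr_const card_ord -[X in X = _]mulr_natl => <-.
  by rewrite mul1r mulrAC divff ?mul1r // pnatr_eq0.
have -> : e i j = e i i *m e i j by rewrite eM eqxx scale1r.
by rewrite mxtrace_mulC eM eq_sym (negbTE nij) scale0r mxtrace0 mul0r.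
Qed.

Let NKK : K.+1%:R / N%:R * (N%:R / K.+1%:R) = 1 :> C.
Proof. by rewrite mulrA divfK ?divff // pnatr_eq0 // -lt0n. Qed.

Lemma inalg_unit k l : inalg e (e k l).
Proof.
rewrite /inalg /condexp (bigD1 k) //= (bigD1 l) //=.
rewrite eM eqxx scale1r mxtrace_unit eqxx mul1r NKK scale1r.
rewrite big1 => [|j nj]; last first.
  by rewrite eM eq_sym (negbTE nj) scale0r mxtrace0 mulr0 scale0r.
rewrite big1 ?addr0 // => i ni; rewrite big1 // => j _.
rewrite eM mxtraceZ mxtrace_unit [k == i]eq_sym (negbTE ni).
by rewrite mul0r !mulr0 scale0r.
Qed.

Lemma inalgL a x y : inalg e x -> inalg e y -> inalg e (a *: x + y).
Proof. by rewrite /inalg linearP /= => -> ->. Qed.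
Lemma inalg0 : inalg e 0. Proof. exact: raddf0. Qed.
Lemma inalgZ a x : inalg e x -> inalg e (a *: x).
Proof. by move=> h; rewrite -[X in inalg e X]addr0; exact: inalgL h inalg0. Qed.
Lemma inalg_sum (I : finType) (f : I -> 'M[C]_N) :
  (forall i, inalg e (f i)) -> inalg e (\sum_i f i).
Proof. by move=> h; rewrite /inalg raddf_sum; apply: eq_bigr => i _; exact: h. Qed.
Lemma inalg1 : inalg e 1%:M.
Proof. by rewrite -e1; apply: inalg_sum => i; exact: inalg_unit. Qed.
Lemma inalg_condexp x : inalg e (condexp e x).
Proof. by do 2!apply: inalg_sum => ?; apply: inalgZ; exact: inalg_unit. Qed.
Lemma condexpMl b x : inalg e b -> condexp e (b *m x) = b *m condexp e x.
Proof.
move: b; apply: inalg_ind => [|a b c hb hc|k l].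
- by rewrite !mul0mx raddf0.
- by rewrite !mulmxDl -!scalemxAl linearP /= hb hc.
rewrite /condexp mulmx_sumr (bigD1 k) //= [X in _ + X]big1 ?addr0 => [|i ni];
  last first.
  rewrite big1 // => j _; rewrite -mulmxA mxtrace_mulC -mulmxA eM (negbTE ni).
  by rewrite scale0r mulmx0 mxtrace0 mulr0 scale0r.
rewrite [RHS](bigD1 l) //= [X in _ = _ + X]big1 ?addr0 => [|i ni]; last first.
  rewrite mulmx_sumr big1 // => j _; rewrite -scalemxAr eM eq_sym (negbTE ni).
  by rewrite scale0r scaler0.
rewrite mulmx_sumr; apply: eq_bigr => j _; rewrite -scalemxAr eM eqxx scale1r.
by rewrite -mulmxA mxtrace_mulC -mulmxA eM eqxx scale1r.
Qed.

Lemma condexp_adj x : (condexp e x)^t* = condexp e (x^t*).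
Proof.
rewrite /condexp exchange_big /= raddf_sum /= raddf_sum; apply: eq_bigr => i _.
rewrite raddf_sum /= raddf_sum; apply: eq_bigr => j _ /=.
rewrite linearZ /= map_mxZ /= eA; congr (_ *: _).
rewrite !rmorphM /= fmorphV !rmorph_nat; congr (_ * _).
by rewrite -trace_map_mx -mxtrace_tr map_trmx trmx_mul map_mxM /= eA mxtrace_mulC.
Qed.

Lemma inalg_adj x : inalg e x -> inalg e (x^t*).
Proof. by move=> h; rewrite /inalg -condexp_adj h. Qed.

Lemma condexpMr b x : inalg e b -> condexp e (x *m b) = condexp e x *m b.
Proof.
move=> hb; rewrite -[LHS]trmxCK condexp_adj trmx_mul map_mxM /=.
rewrite condexpMl; last exact: inalg_adj.
by rewrite -condexp_adj trmx_mul map_mxM /= !trmxCK.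
Qed.

Lemma condexp_comC c x : incom e c -> condexp e (c *m x) = condexp e (x *m c).
Proof.
move=> hc; apply: eq_bigr => i _; apply: eq_bigr => j _; congr (_ * _ *: _).
by rewrite -mulmxA mxtrace_mulC -!mulmxA hc.
Qed.

Lemma incom_alg b c : incom e c -> inalg e b -> c *m b = b *m c.
Proof.
move=> hc; move: b; apply: inalg_ind => [|a x y hx hy|i j]; last exact: hc.
- by rewrite mulmx0 mul0mx.
- by rewrite mulmxDl mulmxDr -scalemxAl -scalemxAr hx hy.
Qed.

(* The Casimir tensor [\sum e_ij (x) e_ji] commutes with the algebra. *)
Lemma casimirL (T : {linear 'M[C]_N -> 'M[C]_N}) b : inalg e b ->
  \sum_i \sum_j T (b *m e i j) *m e j i =
  (\sum_i \sum_j T (e i j) *m e j i) *m b.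
Proof.
move: b; apply: inalg_ind => [|a x y hx hy|k l].
- rewrite mulmx0 big1 // => i _; rewrite big1 // => j _.
  by rewrite mul0mx raddf0 mul0mx.
- rewrite mulmxDr -scalemxAr -hx -hy scaler_sumr -big_split.
  apply: eq_bigr => i _ /=; rewrite scaler_sumr -big_split.
  apply: eq_bigr => j _ /=.
  by rewrite mulmxDl -scalemxAl linearP mulmxDl -scalemxAl.
rewrite (bigD1 l) //= [X in _ + X]big1 ?addr0 => [|i ni]; last first.
  rewrite big1 // => j _; rewrite eM eq_sym (negbTE ni) scale0r raddf0.
  by rewrite mul0mx.
rewrite mulmx_suml [RHS](bigD1 k) //= [X in _ = _ + X]big1 ?addr0 => [|i ni].
  rewrite mulmx_suml; apply: eq_bigr => j _; rewrite eM eqxx scale1r.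
  by rewrite -mulmxA eM eqxx scale1r.
rewrite mulmx_suml big1 // => j _.
by rewrite -mulmxA eM (negbTE ni) scale0r mulmx0.
Qed.

(** The other invariance of the tensor: a factor [b] to the right of e_ij may be moved to the left
    of e_ji. Here it is contracted with [T] on the first leg. *)
Lemma casimirR (T : {linear 'M[C]_N -> 'M[C]_N}) b : inalg e b ->
  \sum_i \sum_j T (e i j *m b) *m e j i =
  \sum_i \sum_j T (e i j) *m b *m e j i.
Proof.
move: b; apply: inalg_ind => [|a x y hx hy|k l].
- apply: eq_bigr => i _; apply: eq_bigr => j _.
  by rewrite !mulmx0 raddf0 mul0mx.
- transitivity (\sum_i \sum_j (a *: (T (e i j *m x) *m e j i)
      + T (e i j *m y) *m e j i)).
    apply: eq_bigr => i _; apply: eq_bigr => j _.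
    by rewrite mulmxDr -scalemxAr linearP mulmxDl -scalemxAl.
  under eq_bigr do rewrite big_split /= -scaler_sumr.
  rewrite big_split /= -scaler_sumr hx hy scaler_sumr -big_split.
  apply: eq_bigr => i _ /=; rewrite scaler_sumr -big_split.
  apply: eq_bigr => j _ /=.
  by rewrite mulmxDr mulmxDl -scalemxAr -scalemxAl.
apply: eq_bigr => i _.
rewrite (bigD1 k) //= [X in _ + X]big1 ?addr0 => [|j nj]; last first.
  by rewrite eM (negbTE nj) scale0r raddf0 mul0mx.
rewrite [RHS](bigD1 l) //= [X in _ = _ + X]big1 ?addr0 => [|j nj].
  by rewrite eM eqxx scale1r -mulmxA eM eqxx scale1r.
by rewrite -mulmxA eM eq_sym (negbTE nj) scale0r mulmx0.
Qed.

(** Presents the commutant expectation as a Casimir contraction with [mulmxr x] in the place of [T],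
    the form to which [casimirL], [casimirR] and [opnorm_avg] apply. *)
Lemma commexpE x : commexp e x = K.+1%:R^-1 *: \sum_i \sum_j mulmxr x (e i j) *m e j i.
Proof. by []. Qed.

Lemma commexp_com x : incom e (commexp e x).
Proof.
move=> k l; have hb := inalg_unit k l.
rewrite commexpE -scalemxAl -scalemxAr -(casimirL (mulmxr x) hb).
rewrite mulmx_sumr; congr (_ *: _); apply: eq_bigr => i _.
by rewrite mulmx_sumr; apply: eq_bigr => j _; rewrite /= !mulmxA.
Qed.

Lemma commexp_algC b x : inalg e b -> commexp e (b *m x) = commexp e (x *m b).
Proof.
move=> hb; rewrite !commexpE; congr (_ *: _).
transitivity (\sum_i \sum_j mulmxr x (e i j *m b) *m e j i).
  by apply: eq_bigr => i _; apply: eq_bigr => j _; rewrite /= !mulmxA.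
rewrite (casimirR (mulmxr x) hb).
by apply: eq_bigr => i _; apply: eq_bigr => j _; rewrite /= !mulmxA.
Qed.

Lemma sum_unit_adj : K.+1%:R^-1 *: \sum_i \sum_j e i j *m e j i = 1%:M.
Proof.
under eq_bigr do under eq_bigr do rewrite eM eqxx scale1r.
under eq_bigr do rewrite sumr_const card_ord.
by rewrite sumrMnl e1 -[_%:M *+ _]scaler_nat scalerA mulVf ?scale1r // pnatr_eq0.
Qed.

Lemma commexpMl c x : incom e c -> commexp e (c *m x) = c *m commexp e x.
Proof.
move=> hc; rewrite /commexp -scalemxAr mulmx_sumr; congr (_ *: _).
apply: eq_bigr => i _; rewrite mulmx_sumr; apply: eq_bigr => j _.
by rewrite !mulmxA hc.
Qed.

Lemma commexpMr c x : incom e c -> commexp e (x *m c) = commexp e x *m c.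
Proof.
move=> hc; rewrite /commexp -scalemxAl mulmx_suml; congr (_ *: _).
apply: eq_bigr => i _; rewrite mulmx_suml; apply: eq_bigr => j _.
by rewrite -!mulmxA hc.
Qed.

Lemma commexp1 : commexp e 1%:M = 1%:M.
Proof.
rewrite /commexp -[RHS]sum_unit_adj.
by under eq_bigr do under eq_bigr do rewrite mulmx1.
Qed.

Lemma commexp_id c : incom e c -> commexp e c = c.
Proof. by move=> hc; rewrite -{1}(mulmx1 c) commexpMl // commexp1 mulmx1. Qed.

Lemma condexp_commexp x : condexp e (commexp e x) = commexp e (condexp e x).
Proof.
rewrite /commexp (linearZ_LR (condexp e)) (raddf_sum (condexp e)) /=; congr (_ *: _).
apply: eq_bigr => i _.
rewrite (raddf_sum (condexp e)); apply: eq_bigr => j _ /=.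
by rewrite condexpMr ?condexpMl //; exact: inalg_unit.
Qed.

Lemma commexp_adj x : (commexp e x)^t* = commexp e (x^t*).
Proof.
rewrite /commexp linearZ /= map_mxZ /= fmorphV rmorph_nat; congr (_ *: _).
rewrite raddf_sum /= raddf_sum; apply: eq_bigr => i _.
rewrite raddf_sum /= raddf_sum; apply: eq_bigr => j _ /=.
by rewrite !trmx_mul !map_mxM /= !eA mulmxA.
Qed.

End Fixed.
End MatrixUnits.

(** * Norm bounds for expectations and Casimir means, uniform in the dimension *)

Section Averaging.
Variables (R : realType) (N K : nat).
Hypothesis N_gt0 : (0 < N)%N.
Local Notation C := R[i].
Local Notation normc := Normc.normc.
Variable e : 'I_K.+1 -> 'I_K.+1 -> 'M[C]_N.
Hypothesis eU : matrix_units e.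
Implicit Types (x y z b c : 'M[C]_N) (S T : {linear 'M[C]_N -> 'M[C]_N}).

Let eM i j k l : e i j *m e k l = (j == k)%:R *: e i l.
Proof. by case: eU. Qed.
Let eA i j : (e i j)^t* = e j i.
Proof. by case: eU. Qed.
Let e1 : \sum_i e i i = 1%:M.
Proof. by case: eU. Qed.

Lemma dotc_suml (I : finType) (f : I -> 'cV[C]_N) w :
  dotc (\sum_i f i) w = \sum_i dotc (f i) w.
Proof.
elim/big_rec2: _ => [|i v1 v2 _ <-]; last by rewrite dotcDl.
by rewrite /dotc trmx0 map_mx0 mul0mx mxE.
Qed.

Lemma dotc_sumr (I : finType) (f : I -> 'cV[C]_N) w :
  dotc w (\sum_i f i) = \sum_i dotc w (f i).
Proof.
elim/big_rec2: _ => [|i v1 v2 _ <-]; last by rewrite dotcDr.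
by rewrite /dotc mulmx0 mxE.
Qed.

Lemma mxtrace_dotc x : \tr x = \sum_m dotc (delta_mx m 0) (x *m delta_mx m 0).
Proof.
apply: eq_bigr => m _; rewrite -colE dotcE (bigD1 m) //= big1 ?addr0.
  by rewrite !mxE !eqxx rmorph1 mul1r.
by move=> i ni; rewrite !mxE (negbTE ni) rmorph0 mul0r.
Qed.

Let F (v : 'cV[C]_N) (p : 'I_N * 'I_N) : 'cV[C]_N :=
  \sum_j (e 0 j *m v) p.1 0 *: (e j 0 *m delta_mx p.2 0).

(* [condexp e x] is the compression of [x (x) 1] to the copy of [C^N] embedded by [F];
   at [x = 1] this says that [F] is isometric up to scale. *)
Lemma dotc_condexp x v w : dotc w (condexp e x *m v) =
  K.+1%:R / N%:R * \sum_p dotc (F w p) (x *m F v p).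
Proof.
transitivity (\sum_i \sum_j \sum_m \sum_a K.+1%:R / N%:R *
   (((e 0 i *m w) a 0)^* * (e 0 j *m v) a 0 *
   dotc (e i 0 *m delta_mx m 0) (x *m (e j 0 *m delta_mx m 0)))).
  rewrite /condexp mulmx_suml dotc_sumr; apply: eq_bigr => i _.
  rewrite mulmx_suml dotc_sumr; apply: eq_bigr => j _.
  rewrite -scalemxAl dotcZr.
  have -> : dotc w (e i j *m v) = dotc (e 0 i *m w) (e 0 j *m v).
    by rewrite -(eA i 0) -dotc_adj mulmxA eM eqxx scale1r.
  have -> : \tr (x *m e j i) = \sum_m
      dotc (e i 0 *m delta_mx m 0) (x *m (e j 0 *m delta_mx m 0)).
    have -> : e j i = e j 0 *m e 0 i by rewrite eM eqxx scale1r.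
    rewrite mulmxA mxtrace_mulC mxtrace_dotc; apply: eq_bigr => m _.
    by rewrite -!mulmxA [LHS]dotc_adj eA.
  rewrite dotcE -[LHS]mulrA mulr_suml mulr_sumr; apply: eq_bigr => m _.
  by rewrite !mulr_sumr; apply: eq_bigr => a _; ring.
rewrite mulr_sumr.
under eq_bigr do under eq_bigr do rewrite exchange_big /= pair_big /=.
under eq_bigr do rewrite exchange_big.
rewrite exchange_big; apply: eq_bigr => -[a m] _ /=.
rewrite /F /= dotc_suml mulr_sumr; apply: eq_bigr => i _.
rewrite mulmx_sumr dotc_sumr mulr_sumr; apply: eq_bigr => j _ /=.
by rewrite dotcZl -scalemxAr dotcZr; ring.
Qed.

Lemma opnorm_condexp x : opnorm (condexp e x) <= opnorm x.
Proof.
apply: opnorm_le_dot => [|v w]; first exact: opnorm_ge0.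
pose k : R := K.+1%:R / N%:R.
have k0 : 0 < k by rewrite divr_gt0 // ltr0n.
have kC : K.+1%:R / N%:R = k%:C.
  by rewrite /k rmorphM /= fmorphV !rmorph_nat.
have FF u : k * \sum_p l2norm (F u p) ^+ 2 = l2norm u ^+ 2.
  apply: complexI; rewrite -dotcvv -[X in dotc u X]mul1mx.
  have <- : condexp e 1%:M = 1%:M by exact: inalg1.
  rewrite dotc_condexp kC rmorphM rmorph_sum /=; congr (_ * _).
  by apply: eq_bigr => p _; rewrite mul1mx dotcvv.
have [/l2norm_eq0 v0|v0] := eqVneq (l2norm v) 0.
  rewrite v0 mulmx0 /dotc mulmx0 mxE Normc.normc0.
  by rewrite !mulr_ge0 ?opnorm_ge0 ?l2norm_ge0.
have [/l2norm_eq0 w0|w0] := eqVneq (l2norm w) 0.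
  rewrite w0 /dotc trmx0 map_mx0 mul0mx mxE Normc.normc0.
  by rewrite !mulr_ge0 ?opnorm_ge0 ?l2norm_ge0.
have vp : 0 < l2norm v by rewrite lt_def v0 l2norm_ge0.
have wp : 0 < l2norm w by rewrite lt_def w0 l2norm_ge0.
(* With this weight the AM-GM bounds, summed over [p] by means of [FF], collapse to
   [opnorm x * (l2norm v * l2norm w)]. *)
pose s := l2norm v / l2norm w.
have s0 : 0 < s by rewrite divr_gt0.
have H p : normc (dotc (F w p) (x *m F v p)) <=
    opnorm x / 2 * (s * l2norm (F w p) ^+ 2 + s^-1 * l2norm (F v p) ^+ 2).
  apply: le_trans (cauchy_schwarz _ _) _.
  apply: le_trans (_ : l2norm (F w p) * (opnorm x * l2norm (F v p)) <= _).
    by rewrite ler_wpM2l ?l2norm_ge0 // le_opnorm.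
  set a := l2norm _; set b := l2norm _; set o := opnorm x.
  have : 0 <= o * (s^-1 * (s * a - b) ^+ 2).
    rewrite mulr_ge0 ?opnorm_ge0 // mulr_ge0 ?sqr_ge0 //.
    by rewrite invr_ge0 ltW.
  have -> : o * (s^-1 * (s * a - b) ^+ 2) =
     o * (s * a ^+ 2 + s^-1 * b ^+ 2) - 2 * (a * (o * b)).
    by field; rewrite gt_eqF.
  lra.
rewrite dotc_condexp kC Normc.normcM.
have -> : normc k%:C = k.
  by apply: complexI; rewrite -normcE ger0_norm // ler0c ltW.
have -> : opnorm x * (l2norm v * l2norm w) =
   opnorm x / 2 * (s * l2norm w ^+ 2 + s^-1 * l2norm v ^+ 2).
  by rewrite /s; field; rewrite v0 w0.
rewrite -!FF.
have -> : opnorm x / 2 * (s * (k * \sum_p l2norm (F w p) ^+ 2) +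
    s^-1 * (k * \sum_p l2norm (F v p) ^+ 2)) =
  k * \sum_p opnorm x / 2 * (s * l2norm (F w p) ^+ 2 + s^-1 * l2norm (F v p) ^+ 2).
  by rewrite -mulr_sumr big_split /= -!mulr_sumr; ring.
rewrite ler_wpM2l ?(ltW k0) // -lecR -normcE rmorph_sum /=.
apply: le_trans (ler_norm_sum _ _ _) _.
by apply: ler_sum => p _; rewrite normcE lecR.
Qed.

Let signs := {ffun 'I_K.+1 -> bool}.

(* Unitaries of the algebra whose average realizes the Casimir tensor. *)
Definition sgn_shift (p : signs * 'I_K.+1) : 'M[C]_N :=
  \sum_i (-1) ^+ (p.1 i) *: e i (i + p.2).

Lemma sgn_shift_adj p :
  (sgn_shift p)^t* = \sum_i (-1) ^+ (p.1 i) *: e (i + p.2) i.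
Proof.
rewrite /sgn_shift raddf_sum /= raddf_sum; apply: eq_bigr => i _ /=.
by rewrite linearZ /= map_mxZ /= eA rmorphXn /= rmorphN1.
Qed.

Lemma sgn_shift_unitary p : sgn_shift p \is unitarymx.
Proof.
apply/unitarymxP; rewrite sgn_shift_adj /sgn_shift mulmx_suml -[RHS]e1.
apply: eq_bigr => i _; rewrite mulmx_sumr (bigD1 i) //= big1 ?addr0.
  by rewrite -scalemxAl -scalemxAr eM eqxx scale1r scalerA -expr2 sqrr_sign scale1r.
move=> j nj; rewrite -scalemxAl -scalemxAr eM eq_sym (inj_eq (addIr _)).
by rewrite (negbTE nj) scale0r !scaler0.
Qed.

Lemma sgn_shift_inalg p : inalg e (sgn_shift p).
Proof. by apply: inalg_sum => i; apply: inalgZ; exact: inalg_unit. Qed.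

(** Orthogonality of independent signs: for [i != k], flipping the sign at [i] is an involution of
    the index set that negates every term. *)
Lemma sum_signs (i k : 'I_K.+1) :
  \sum_(s : signs) (-1) ^+ (s i) * (-1) ^+ (s k) =
  #|{: signs}|%:R * (i == k)%:R :> C.
Proof.
have [->|nik] := eqVneq i k.
  under eq_bigr do rewrite -expr2 sqrr_sign.
  by rewrite sumr_const mulr1.
rewrite mulr0; set t := \sum_s _.
pose flip (s : signs) : signs := [ffun j => if j == i then ~~ s j else s j].
have flipK : involutive flip.
  move=> s; apply/ffunP => j; rewrite !ffunE.
  by case: (j == i); rewrite ?negbK.
suff : t = - t by move/eqP; rewrite -addr_eq0 -mulr2n mulrn_eq0 /= => /eqP.
rewrite {1}/t (reindex_inj (inv_inj flipK)) /= /t -sumrN; apply: eq_bigr => s _.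
rewrite !ffunE eqxx eq_sym (negbTE nik).
by case: (s i); rewrite /= ?expr0 ?expr1 ?mulN1r ?mul1r ?opprK.
Qed.

(** By [avg_shift] this is the mean of [S w *m w^t*] over the unitaries [w = sgn_shift p] of the
    algebra. For [S = mulmxr x] it is [commexp e x]. *)
Definition avg (S : 'M[C]_N -> 'M[C]_N) : 'M[C]_N :=
  K.+1%:R^-1 *: \sum_i \sum_j S (e i j) *m e j i.

(** Expanding both factors gives a double sum over [i] and [k]; the signs remove the terms with
    [i != k], and as the cyclic shift varies [i + p.2] runs through all indices. *)
Lemma avg_shift S : (#|{: signs}|%:R * K.+1%:R) *: avg S =
  \sum_(p : signs * 'I_K.+1) S (sgn_shift p) *m (sgn_shift p)^t*.
Proof.
rewrite /avg scalerA -mulrA divff ?mulr1 ?pnatr_eq0 //.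
transitivity (\sum_(p : signs * 'I_K.+1) \sum_i \sum_k
   ((-1) ^+ (p.1 i) * (-1) ^+ (p.1 k)) *:
   (S (e i (i + p.2)) *m e (k + p.2) k)); last first.
  apply: eq_bigr => p _; rewrite sgn_shift_adj /sgn_shift (raddf_sum S) mulmx_suml.
  apply: eq_bigr => i _; rewrite mulmx_sumr; apply: eq_bigr => k _ /=.
  by rewrite (linearZ_LR S) -scalemxAl -scalemxAr scalerA.
rewrite [RHS]exchange_big scaler_sumr; apply: eq_bigr => i _ /=.
have sumE k (G : 'I_K.+1 -> 'M[C]_N) :
    \sum_(p : signs * 'I_K.+1) ((-1) ^+ (p.1 i) * (-1) ^+ (p.1 k)) *: G p.2 =
    (#|{: signs}|%:R * (i == k)%:R) *: \sum_c G c.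
  transitivity (\sum_(s : signs) \sum_c ((-1) ^+ (s i) * (-1) ^+ (s k)) *: G c).
    by rewrite pair_bigA.
  rewrite exchange_big scaler_sumr; apply: eq_bigr => c _.
  by rewrite -scaler_suml sum_signs.
rewrite [RHS]exchange_big /= [RHS](bigD1 i) //= [X in _ = _ + X]big1 ?addr0.
  rewrite (sumE i (fun d => S (e i (i + d)) *m e (i + d) i)) eqxx mulr1.
  by rewrite (reindex_inj (addrI i)).
move=> k nk; rewrite (sumE k (fun d => S (e i (i + d)) *m e (k + d) k)).
by rewrite eq_sym (negbTE nk) mulr0 scale0r.
Qed.

(** A mean over unitaries loses nothing in norm, whereas bounding the terms of [avg] one by one
    would cost a factor [K.+1]. *)
Lemma opnorm_avg S (k : R) : 0 <= k ->
  (forall x, inalg e x -> opnorm (S x) <= k * opnorm x) -> opnorm (avg S) <= k.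
Proof.
move=> k0 h; pose m : R := #|{: signs}|%:R * K.+1%:R.
have m0 : 0 < m.
  by rewrite mulr_gt0 ?ltr0n //; apply/card_gt0P; exists [ffun=> true].
have mC : #|{: signs}|%:R * K.+1%:R = m%:C.
  by rewrite rmorphM /= !rmorph_nat.
have nmV : normc (m%:C)^-1 = m^-1.
  apply: complexI; rewrite -normcE ger0_norm ?fmorphV //.
  by rewrite invr_ge0 ler0c ltW.
have -> : avg S = (m%:C)^-1 *:
    \sum_(p : signs * 'I_K.+1) S (sgn_shift p) *m (sgn_shift p)^t*.
  rewrite -avg_shift mC scalerA mulVf ?scale1r //.
  by rewrite -(rmorph0 (real_complex R)) (inj_eq (@complexI _)) gt_eqF.
apply: le_trans (opnormZ _ _) _; rewrite nmV mulrC ler_pdivrMr //.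
apply: le_trans (opnorm_sum _) _.
apply: le_trans (_ : \sum_(p : signs * 'I_K.+1) k <= _); last first.
  rewrite sumr_const card_prod card_ord -[X in X <= _]mulr_natr /m natrM.
  by rewrite mulrC.
apply: ler_sum => p _; apply: le_trans (opnormM _ _) _.
rewrite -[leRHS]mulr1; apply: ler_pM; rewrite ?opnorm_ge0 //.
  apply: le_trans (h _ (sgn_shift_inalg p)) _.
  by apply: ler_piMr => //; apply: opnorm_unitary; exact: sgn_shift_unitary.
by apply: opnorm_unitary; rewrite trmxC_unitary sgn_shift_unitary.
Qed.

Lemma opnorm_commexp x : opnorm (commexp e x) <= opnorm x.
Proof.
rewrite (commexpE e x); apply: (@opnorm_avg (mulmxr x)); first exact: opnorm_ge0.
by move=> y _ /=; rewrite mulrC opnormM.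
Qed.

End Averaging.

Ltac opnorm_lra :=
  repeat match goal with
  | |- context [opnorm ?x] => generalize (opnorm x); intro
  end;
  repeat match goal with
  | H : context [opnorm _] |- _ => clear H
  | H : context [mulmx _ _] |- _ => clear H
  end; lra.

Ltac opnorm_ring :=
  repeat match goal with
  | |- context [opnorm ?x] => generalize (opnorm x); intro
  end;
  repeat match goal with
  | H : context [opnorm _] |- _ => clear H
  | H : context [mulmx _ _] |- _ => clear H
  end; ring.

(** * The defect of a superoperator *)

Lemma subr_interchange (V : zmodType) (a b c d : V) :
  a - b - (c - d) = a - c - (b - d).
Proof.
rewrite !opprB -!addrA; congr (_ + _).
by rewrite addrCA [RHS]addrCA [- b - c]addrC.
Qed.

Section Defect.
Variables (R : realType) (N K : nat).
Hypothesis N_gt0 : (0 < N)%N.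
Local Notation C := R[i].
Implicit Types (e : 'I_K.+1 -> 'I_K.+1 -> 'M[C]_N) (x y z b c : 'M[C]_N).
Implicit Types (S T : {linear 'M[C]_N -> 'M[C]_N}).

Definition commutator z x : 'M[C]_N := z *m x - x *m z.

Lemma commutatorE z x : commutator z x = z *m x - x *m z.
Proof. by []. Qed.

Lemma commutator_is_linear z : linear (commutator z).
Proof.
move=> a x y; rewrite /commutator mulmxDr mulmxDl -scalemxAr -scalemxAl.
by rewrite scalerBr opprD addrACA.
Qed.
HB.instance Definition _ z :=
  GRing.isLinear.Build C 'M[C]_N 'M[C]_N _ (commutator z) (commutator_is_linear z).

Lemma commutatorDl y z x :
  commutator (y + z) x = commutator y x + commutator z x.
Proof. by rewrite /commutator mulmxDl mulmxDr opprD addrACA. Qed.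

Lemma commutatorM z x y :
  commutator z (x *m y) = commutator z x *m y + x *m commutator z y.
Proof. by rewrite /commutator mulmxBl mulmxBr !mulmxA addrA subrK. Qed.

Lemma opnorm_commutator z x : opnorm (commutator z x) <= 2 * opnorm z * opnorm x.
Proof.
apply: le_trans (opnormB _ _) _.
by have := opnormM z x; have := opnormM x z; opnorm_lra.
Qed.

(* The component of [x] orthogonal to the algebra and to its commutant. *)
Definition offdiag e x : 'M[C]_N :=
  (x - condexp e x) - commexp e (x - condexp e x).

Lemma offdiag_is_linear e : linear (offdiag e).
Proof.
exact: (linearP ((idfun \- commexp e) \o (idfun \- condexp e)
  : {linear 'M[C]_N -> 'M[C]_N})).
Qed.
HB.instance Definition _ e :=
  GRing.isLinear.Build C 'M[C]_N 'M[C]_N _ (offdiag e) (offdiag_is_linear e).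

(* At [S = commutator z] with [z] off-diagonal this is [z]: it recovers, modulo the
   algebra and its commutant, an infinitesimal displacement from its action. *)
Definition defect e (S : 'M[C]_N -> 'M[C]_N) := offdiag e (avg e S).

(** The skew-hermitian part of the defect is the part that an infinitesimal unitary rotation can
    remove. Controlling it is enough, because the generator iH to be estimated is itself
    skew-hermitian. *)
Definition skew x : 'M[C]_N := 2^-1 *: (x - x^t*).

Lemma adjD x y : (x + y)^t* = x^t* + y^t*.
Proof. by rewrite raddfD /= map_mxD. Qed.
Lemma adjN x : (- x)^t* = - x^t*.
Proof. by rewrite raddfN /= map_mxN. Qed.
Lemma adjB x y : (x - y)^t* = x^t* - y^t*.
Proof. by rewrite adjD adjN. Qed.
Lemma adjZ (a : C) x : (a *: x)^t* = a^* *: x^t*.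
Proof. by rewrite linearZ /= map_mxZ. Qed.
Lemma adjM x y : (x *m y)^t* = y^t* *m x^t*.
Proof. by rewrite trmx_mul map_mxM. Qed.
Lemma adj1 : (1%:M)^t* = 1%:M :> 'M[C]_N.
Proof. by rewrite trmx1 map_mx1. Qed.

Lemma skewD x y : skew (x + y) = skew x + skew y.
Proof. by rewrite /skew adjD opprD addrACA scalerDr. Qed.
Lemma skewN x : skew (- x) = - skew x.
Proof. by rewrite /skew adjN -opprD scalerN. Qed.
Lemma skew_adj x : (skew x)^t* = - skew x.
Proof.
rewrite /skew adjZ adjB trmxCK fmorphV rmorph_nat -scalerN opprB.
by [].
Qed.
Lemma skew_id x : x^t* = - x -> skew x = x.
Proof.
move=> h; by rewrite /skew h opprK -mulr2n -[x *+ 2]scaler_nat scalerA mulVf ?scale1r //.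
Qed.

Lemma normcR (k : R) : 0 <= k -> Normc.normc k%:C = k.
Proof. by move=> k0; apply: complexI; rewrite -normcE ger0_norm // ler0c. Qed.

Lemma opnormZR (k : R) x : 0 <= k -> opnorm (k%:C *: x) <= k * opnorm x.
Proof. by move=> k0; have := opnormZ k%:C x; rewrite normcR. Qed.

Lemma opnorm_skew x : opnorm (skew x) <= opnorm x.
Proof.
have -> : skew x = (2^-1 : R)%:C *: (x - x^t*) by rewrite /skew fmorphV rmorph_nat.
have h0 : 0 <= 2^-1 :> R by rewrite invr_ge0 ler0n.
apply: le_trans (opnormZR _ h0) _; apply: le_trans (ler_wpM2l h0 (opnormB _ _)) _.
by have := opnorm_adj x; opnorm_lra.
Qed.

Lemma skew_commutator z x : z^t* = - z ->
  skew (commutator z x) = commutator z (skew x).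
Proof.
move=> zA; rewrite /skew /commutator adjB !adjM zA mulmxN mulNmx opprK.
rewrite -scalemxAr -scalemxAl -scalerBr; congr (_ *: _).
rewrite mulmxBr mulmxBl !opprD !opprK.
by rewrite [RHS]addrACA; congr (_ + _); exact: addrC.
Qed.

(* Weaker than closeness of [T] to [condexp e] in norm, which is why no
   unitary conjugating one nearby algebra to another is ever needed. *)
Definition almost_fixing e (T : 'M[C]_N -> 'M[C]_N) (k : R) : Prop :=
  [/\ forall x, inalg e x -> opnorm (T x - x) <= k * opnorm x,
      forall x, opnorm (T x - condexp e (T x)) <= k * opnorm x
    & forall x, opnorm (T x) <= opnorm x].

Section Fixed.
Variable e : 'I_K.+1 -> 'I_K.+1 -> 'M[C]_N.
Hypothesis eU : matrix_units e.

Lemma opnorm_sub_condexp x : opnorm (x - condexp e x) <= 2 * opnorm x.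
Proof.
apply: le_trans (opnormB _ _) _.
by have := opnorm_condexp N_gt0 eU x; opnorm_lra.
Qed.

(** The units lie in the algebra, so [condexp e] passes under [avg]: only what [S] moves out of the
    algebra contributes. The factor 2 pays for subtracting [commexp e]. *)
Lemma opnorm_defect S (k : R) : 0 <= k ->
  (forall x, inalg e x -> opnorm (S x - condexp e (S x)) <= k * opnorm x) ->
  opnorm (defect e S) <= 2 * k.
Proof.
move=> k0 h; set y := avg e S - condexp e (avg e S).
have yE : y = avg e (S \- (condexp e \o S)).
  rewrite /y /avg (linearZ_LR (condexp e)) -scalerBr; congr (_ *: _).
  rewrite (raddf_sum (condexp e)) -sumrB; apply: eq_bigr => i _.
  rewrite (raddf_sum (condexp e)) -sumrB; apply: eq_bigr => j _ /=.
  by rewrite (condexpMr eU) ?mulmxBl //; exact: inalg_unit.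
have yk : opnorm y <= k by rewrite yE; exact: opnorm_avg.
rewrite /defect /offdiag -/y; apply: le_trans (opnormB _ _) _.
by have := opnorm_commexp N_gt0 eU y; move: yk; opnorm_lra.
Qed.

Lemma avgD (S T : 'M[C]_N -> 'M[C]_N) :
  avg e (fun x => S x + T x) = avg e S + avg e T.
Proof.
rewrite /avg -scalerDr; congr (_ *: _); rewrite -big_split; apply: eq_bigr => i _.
by rewrite -big_split; apply: eq_bigr => j _ /=; rewrite mulmxDl.
Qed.

Lemma eq_avg (S T : 'M[C]_N -> 'M[C]_N) : S =1 T -> avg e S = avg e T.
Proof.
move=> h; rewrite /avg; congr (_ *: _).
by apply: eq_bigr => i _; apply: eq_bigr => j _; rewrite h.
Qed.

Lemma defectD (S T : 'M[C]_N -> 'M[C]_N) :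
  defect e (fun x => S x + T x) = defect e S + defect e T.
Proof. by rewrite /defect avgD raddfD. Qed.

Lemma eq_defect (S T : 'M[C]_N -> 'M[C]_N) : S =1 T -> defect e S = defect e T.
Proof. by move=> h; rewrite /defect (eq_avg h). Qed.

Lemma offdiag_com c : incom e c -> offdiag e c = 0.
Proof.
move=> hc; rewrite /offdiag raddfB /= -condexp_commexp // commexp_id //.
by rewrite subrr.
Qed.

Lemma offdiag_alg b : inalg e b -> offdiag e b = 0.
Proof. by move=> hb; rewrite /offdiag hb subrr raddf0 subrr. Qed.

Lemma offdiag_split x : x - offdiag e x =
  condexp e x + commexp e (x - condexp e x).
Proof. by rewrite /offdiag opprB addrCA subKr addrC. Qed.

Lemma offdiagK x : offdiag e (offdiag e x) = offdiag e x.
Proof.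
rewrite {2}/offdiag raddfB /= [offdiag e (commexp _ _)]offdiag_com ?subr0; last first.
  exact: commexp_com.
by rewrite raddfB /= [offdiag e (condexp e x)]offdiag_alg ?subr0 //; exact: inalg_condexp.
Qed.

Lemma offdiag_defect (S : 'M[C]_N -> 'M[C]_N) :
  offdiag e (defect e S) = defect e S.
Proof. exact: offdiagK. Qed.

Lemma offdiag_adj x : (offdiag e x)^t* = offdiag e (x^t*).
Proof.
rewrite /offdiag adjB adjB (condexp_adj eU) (commexp_adj eU) adjB.
by rewrite (condexp_adj eU).
Qed.

Lemma offdiag_skew x : offdiag e (skew x) = skew (offdiag e x).
Proof. by rewrite /skew (linearZ_LR (offdiag e)) (raddfB (offdiag e)) offdiag_adj. Qed.

(* Equivariance under the infinitesimal stabilizer of the algebra. *)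
Lemma commutator_avg T z b c : z = b + c -> inalg e b -> incom e c ->
  avg e (fun x => T (commutator z x) - commutator z (T x)) =
  - commutator z (avg e T).
Proof.
move=> -> hb hc; apply/eqP; rewrite -subr_eq0 opprK; apply/eqP.
rewrite /avg linearZ /= -scalerDr; apply/eqP; rewrite scaler_eq0; apply/orP; right.
apply/eqP; rewrite raddf_sum -big_split /=.
(* By the Leibniz rule the outer commutator falls on [e j i], and on units [commutator z] agrees
   with [commutator b], as [c] commutes with them. The four sums that result cancel by [casimirL]
   and [casimirR]. *)
transitivity (\sum_i \sum_j (T (commutator b (e i j)) *m e j i
   + T (e i j) *m commutator b (e j i))).
  apply: eq_bigr => i _; rewrite raddf_sum -big_split; apply: eq_bigr => j _ /=.
  rewrite commutatorM mulmxBl addrA subrK.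
  have hk k l : commutator (b + c) (e k l) = commutator b (e k l).
    by rewrite commutatorDl [commutator c _]/commutator hc subrr addr0.
  by rewrite !hk.
transitivity ((\sum_i \sum_j T (b *m e i j) *m e j i -
   \sum_i \sum_j T (e i j) *m e j i *m b) +
   (\sum_i \sum_j T (e i j) *m b *m e j i -
   \sum_i \sum_j T (e i j *m b) *m e j i)).
  rewrite -!sumrB -big_split; apply: eq_bigr => i _ /=.
  rewrite -!sumrB -big_split; apply: eq_bigr => j _ /=.
  rewrite /commutator raddfB mulmxBl mulmxBr !mulmxA.
  by rewrite addrACA [- _ + - _]addrC addrACA [X in _ + X]addrC -addrACA addrACA.
rewrite casimirL // casimirR // subrr addr0 mulmx_suml; apply/eqP.
by rewrite subr_eq0; apply/eqP/eq_bigr => i _; rewrite mulmx_suml.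
Qed.

Lemma condexp_commutator z b c x : z = b + c -> inalg e b -> incom e c ->
  condexp e (commutator z x) = commutator z (condexp e x).
Proof.
move=> -> hb hc; rewrite !commutatorDl raddfD /=; congr (_ + _).
  by rewrite /commutator raddfB /= condexpMl // condexpMr.
rewrite /commutator raddfB /= condexp_comC // subrr.
by rewrite (incom_alg hc (inalg_condexp N_gt0 eU x)) subrr.
Qed.

Lemma commexp_commutator z b c x : z = b + c -> inalg e b -> incom e c ->
  commexp e (commutator z x) = commutator z (commexp e x).
Proof.
move=> -> hb hc; rewrite !commutatorDl raddfD /=; congr (_ + _).
  rewrite /commutator raddfB /= (commexp_algC eU) // subrr.
  by rewrite (incom_alg (commexp_com N_gt0 eU x) hb) subrr.
by rewrite /commutator raddfB /= commexpMl // commexpMr.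
Qed.

Lemma offdiag_commutator z b c x : z = b + c -> inalg e b -> incom e c ->
  offdiag e (commutator z x) = commutator z (offdiag e x).
Proof.
move=> hz hb hc; rewrite /offdiag (condexp_commutator _ hz hb hc) -raddfB.
by rewrite (commexp_commutator _ hz hb hc) -raddfB.
Qed.

Lemma defect_equivariant T z b c : z = b + c -> inalg e b -> incom e c ->
  defect e (fun x => T (commutator z x) - commutator z (T x)) =
  - commutator z (defect e T).
Proof.
move=> hz hb hc; rewrite /defect (commutator_avg T hz hb hc) raddfN /=.
by rewrite (offdiag_commutator _ hz hb hc).
Qed.

Lemma defect_commutator z : offdiag e z = z -> defect e (commutator z) = z.
Proof.
move=> hz; rewrite /defect.
have -> : avg e (commutator z) = z - commexp e z.
  rewrite commexpE /avg -{2}(mulmx1 z) -(sum_unit_adj eU) -scalemxAr -scalerBr.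
  congr (_ *: _); rewrite mulmx_sumr -sumrB; apply: eq_bigr => i _.
  rewrite mulmx_sumr -sumrB; apply: eq_bigr => j _ /=.
  by rewrite /commutator mulmxBl mulmxA.
by rewrite raddfB /= hz offdiag_com ?subr0 //; exact: commexp_com.
Qed.

(** The derivative of the defect under a rotation by [z] is nearly [- z], so the Newton correction
    is the skew defect itself. After adding [commutator z], the operator is [T \o commutator z]
    minus [commutator z \o (T - id)]: the range of [T] is nearly in the algebra, and [T - id] is
    small on it. The two parts give 2 and 4 times [k * opnorm z], doubled by [opnorm_defect]. *)
Lemma defect_linearization T z (k : R) : 0 <= k -> almost_fixing e T k ->
  offdiag e z = z ->
  opnorm (defect e (fun x => T (commutator z x) - commutator z (T x)) + z) <=
    12 * k * opnorm z.
Proof.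
move=> k0 [Ta Tb Tc] hz; rewrite -{3}(defect_commutator hz) -defectD.
pose S : {linear 'M[C]_N -> 'M[C]_N} :=
  (T \o commutator z) \- (commutator z \o (T \- idfun)).
have -> : defect e (fun x => T (commutator z x) - commutator z (T x) +
    commutator z x) = defect e S.
  apply: eq_defect => x; rewrite /= (raddfB (commutator z)).
  by rewrite [in RHS]opprB [RHS]addrA [RHS]addrAC.
have -> : 12 * k * opnorm z = 2 * (6 * k * opnorm z) by opnorm_ring.
apply: opnorm_defect => [|x hx /=]; first by rewrite !mulr_ge0 ?opnorm_ge0.
set p := T _; set q := commutator z (T x - x).
have -> : p - q - condexp e (p - q) = (p - condexp e p) - (q - condexp e q).
  by rewrite (raddfB (condexp e)) subr_interchange.
apply: le_trans (opnormB _ _) _.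
have hp : opnorm (p - condexp e p) <= k * (2 * opnorm z * opnorm x).
  apply: le_trans (Tb _) _; rewrite ler_wpM2l //; exact: opnorm_commutator.
have hq : opnorm q <= 2 * opnorm z * (k * opnorm x).
  apply: le_trans (opnorm_commutator _ _) _.
  by rewrite ler_wpM2l ?mulr_ge0 ?opnorm_ge0 // Ta.
have := opnorm_sub_condexp q.
have -> : 6 * k * opnorm z * opnorm x = k * (2 * opnorm z * opnorm x)
  + 2 * (2 * opnorm z * (k * opnorm x)) by opnorm_ring.
move: hp hq; opnorm_lra.
Qed.

Lemma opnorm_defect_self T (k : R) : 0 <= k -> almost_fixing e T k ->
  opnorm (defect e T) <= 2 * k.
Proof. by move=> k0 [_ Tb _]; apply: opnorm_defect. Qed.

End Fixed.
End Defect.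

(** Once everything is expanded, each product of matrices is an atom, and the noncommutative
    identity becomes a linear one between entries. *)
Ltac mx_ring :=
  rewrite ?(mulmxDl, mulmxDr, mulmxBl, mulmxBr, mulNmx, mulmxN, mulmx1, mul1mx, mulmxA);
  repeat match goal with
  | |- context [@mulmx ?R ?m ?n ?p ?a ?b] =>
      move: (@mulmx R m n p a b) => ?
  end; apply/matrixP => ? ?; rewrite !mxE; ring.

Lemma le_half_eq0 (R : realFieldType) (p : R) : 0 <= p -> p <= p / 2 -> p = 0.
Proof. by lra. Qed.

Lemma le_half_add (R : realFieldType) (p q r : R) :
  q <= p / 2 -> p <= r + q -> p <= 2 * r.
Proof. by lra. Qed.

(** * Unitaries near the identity *)

Section UnitariesNearOne.
Variables (R : realType) (N K : nat).
Hypothesis N_gt0 : (0 < N)%N.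
Local Notation C := R[i].
Implicit Types (e : 'I_K.+1 -> 'I_K.+1 -> 'M[C]_N) (u x y z : 'M[C]_N).
Implicit Types (S T : {linear 'M[C]_N -> 'M[C]_N}).

Lemma conjR (k : R) : (k%:C : C)^* = k%:C.
Proof. by rewrite conj_Creal //; apply/complex_realP; exists k. Qed.

(** The witness is (1 + w)(1 - w)^-1 with w = z/2, unitary because [z] is skew. It differs from 1 +
    z by exactly z w (1 - w)^-1, where [w] has norm at most [opnorm z / 2] and the inverse at most
    2. *)
Lemma cayley z : z^t* = - z -> opnorm z <= 1 ->
  exists2 u, u \is unitarymx & opnorm (u - 1%:M - z) <= opnorm z ^+ 2.
Proof.
move=> zA z1; pose w := (2^-1 : R)%:C *: z.
have h0 : 0 <= 2^-1 :> R by rewrite invr_ge0 ler0n.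
have wz : w + w = z.
  by rewrite /w -scalerDl -rmorphD /= -[2^-1]mul1r -splitr scale1r.
have wA : w^t* = - w by rewrite /w adjZ zA conjR scalerN.
have wn : opnorm w <= opnorm z / 2.
  by apply: le_trans (opnormZR _ h0) _; rewrite mulrC.
have fix0 (v : 'cV[C]_N) : l2norm (w *m v) <= l2norm v / 2.
  apply: le_trans (le_opnorm _ _) _; rewrite mulrC ler_wpM2l ?l2norm_ge0 //.
  by move: wn z1; opnorm_lra.
have wU : 1%:M - w \in unitmx.
  rewrite -row_free_unit; apply: inj_row_free => v v0.
  suff /(congr1 (fun a => a^t*)) : v^t* = 0 by rewrite trmxCK trmx0 map_mx0.
  apply: l2norm_eq0.
  have := congr1 (fun a => a^t*) v0.
  rewrite trmx0 map_mx0 trmx_mul map_mxM /= adjB adj1 wA opprK mulmxDl mul1mx.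
  move=> /eqP; rewrite addr_eq0 => /eqP h; have := fix0 (v^t*).
  have -> : w *m v^t* = - v^t* by rewrite {2}h opprK.
  rewrite -scaleN1r l2normZ normcN Normc.normc1 mul1r.
  exact: le_half_eq0 (l2norm_ge0 _).
pose i := invmx (1%:M - w).
have iN : opnorm i <= 2.
  apply: opnorm_le => // v.
  have hv : v = i *m v - w *m (i *m v).
    by rewrite -{1}(mul1mx (i *m v)) -mulmxBl mulKVmx.
  have : l2norm (i *m v) <= l2norm v + l2norm (w *m (i *m v)).
    by apply: le_trans (l2normD _ _); rewrite {2}hv subrK.
  move: (fix0 (i *m v)); exact: le_half_add.
have iA : (1%:M + w) *m i^t* = 1%:M.
  rewrite -[LHS]trmxCK adjM trmxCK adjD adj1 wA -/i.
  by rewrite /i mulVmx // adj1.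
have iA' : i^t* *m (1%:M + w) = 1%:M by exact: mulmx1C.
exists ((1%:M + w) *m i).
  rewrite -trmxC_unitary; apply/unitarymxP; rewrite trmxCK adjM adjD adj1 wA.
  rewrite -mulmxA [(1%:M - w) *m _]mulmxA.
  have -> : (1%:M - w) *m (1%:M + w) = (1%:M + w) *m (1%:M - w).
    by mx_ring.
  by rewrite [X in _ *m X]mulmxK.
have -> : (1%:M + w) *m i - 1%:M - z = (w + w) *m w *m i.
  have h : 1%:M = (1%:M - w) *m i by rewrite mulmxV.
  have -> : (1%:M + w) *m i - 1%:M - z = (1%:M + w - (1%:M + z) *m (1%:M - w)) *m i.
    by rewrite mulmxBl -mulmxA mulmxV // mulmx1 opprD addrA.
  by congr (_ *m _); rewrite -wz; move: (w) => a; mx_ring.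
rewrite wz; apply: le_trans (opnormM _ _) _.
apply: le_trans (ler_pM (opnorm_ge0 _) (opnorm_ge0 _) (opnormM _ _) iN) _.
have := ler_wpM2l (opnorm_ge0 z) wn.
by rewrite expr2 mulrA; opnorm_lra.
Qed.

(** Writing u = 1 + z + r, the terms of order zero and one cancel, and four terms of size at most
    [s ^+ 2 * opnorm x] remain. The parameter [s] may exceed [opnorm z], so that it can also absorb
    the Taylor constant of the exponential. *)
Lemma conj_expansion u z x (s : R) : u \is unitarymx -> z^t* = - z ->
  s <= 1 -> opnorm z <= s -> opnorm (u - 1%:M - z) <= s ^+ 2 ->
  opnorm (u *m x *m u^t* - x - commutator z x) <= 4 * s ^+ 2 * opnorm x.
Proof.
move=> uU zA s1 zs; set r := _ - z => rs.
have s0 : 0 <= s by exact: le_trans (opnorm_ge0 z) zs.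
have uE : u = 1%:M + z + r by rewrite /r; mx_ring.
have uA : u^t* = 1%:M - z + r^t* by rewrite {1}uE !adjD adj1 zA.
have -> : u *m x *m u^t* - x - commutator z x =
    r *m x *m u^t* + x *m r^t* - z *m x *m z + z *m x *m r^t*.
  rewrite /commutator; move: (r^t* ) uA => r' uA.
  have -> : u *m x *m u^t* = (1%:M + z) *m x *m u^t* + r *m x *m u^t*.
    by rewrite {1}uE; mx_ring.
  move: (u^t* ) uA => u' uA; rewrite {1}uA; mx_ring.
have rA := opnorm_adj r; have uN : opnorm (u^t*) <= 1.
  by apply: opnorm_unitary; rewrite trmxC_unitary.
have X0 := opnorm_ge0 x.
have s2 : 0 <= s ^+ 2 by rewrite exprn_ge0.
have h1 : opnorm (r *m x *m u^t*) <= s ^+ 2 * opnorm x * 1.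
  exact: (opnormM_le (opnormM_le rs (lexx _)) uN).
have h2 : opnorm (x *m r^t*) <= opnorm x * s ^+ 2.
  exact: (opnormM_le (lexx _) (le_trans rA rs)).
have h3 : opnorm (z *m x *m z) <= s * opnorm x * s.
  exact: (opnormM_le (opnormM_le zs (lexx _)) zs).
have h4 : opnorm (z *m x *m r^t*) <= 1 * opnorm x * s ^+ 2.
  exact: (opnormM_le (opnormM_le (le_trans zs s1) (lexx _)) (le_trans rA rs)).
apply: le_trans (opnormD _ _) _; apply: le_trans (lerD (opnormB _ _) (lexx _)) _.
apply: le_trans (lerD (lerD (opnormD _ _) (lexx _)) (lexx _)) _.
move: h1 h2 h3 h4; opnorm_lra.
Qed.

End UnitariesNearOne.

(** * Equivariance under unitaries and first-order expansion of the defect *)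

Section Conjugation.
Variables (R : realType) (N K : nat).
Hypothesis N_gt0 : (0 < N)%N.
Local Notation C := R[i].
Implicit Types (e : 'I_K.+1 -> 'I_K.+1 -> 'M[C]_N) (u v x y z : 'M[C]_N).
Implicit Types (S T : {linear 'M[C]_N -> 'M[C]_N}).

Lemma opnorm_conj u x : u \is unitarymx -> opnorm (u *m x *m u^t*) <= opnorm x.
Proof.
move=> uU; apply: le_trans (opnormM _ _) _.
have h1 := opnorm_unitary uU.
have h2 : opnorm (u^t*) <= 1 by apply: opnorm_unitary; rewrite trmxC_unitary.
apply: le_trans (ler_piMr (opnorm_ge0 _) h2) _.
by apply: le_trans (opnormM _ _) _; apply: ler_piMl h1; exact: opnorm_ge0.
Qed.

Lemma unitary_adj u : u \is unitarymx -> u^t* \is unitarymx.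
Proof. by rewrite trmxC_unitary. Qed.

Lemma unitarymxV u : u \is unitarymx -> u *m u^t* = 1%:M.
Proof. by move/unitarymxP. Qed.

Lemma opnorm_conj_sub u x : u \is unitarymx ->
  opnorm (u *m x *m u^t* - x) <= 2 * opnorm (u - 1%:M) * opnorm x.
Proof.
move=> uU.
have -> : u *m x *m u^t* - x = (u - 1%:M) *m x *m u^t* + x *m (u - 1%:M)^t*.
  by rewrite adjB adj1; mx_ring.
have h1 := opnorm_adj (u - 1%:M).
have h2 : opnorm (u^t*) <= 1 by apply/opnorm_unitary/unitary_adj.
apply: le_trans (opnormD _ _) _.
have h3 : opnorm ((u - 1%:M) *m x *m u^t*) <= opnorm (u - 1%:M) * opnorm x.
  apply: le_trans (opnormM _ _) _.
  by apply: le_trans (ler_piMr (opnorm_ge0 _) h2) _; exact: opnormM.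
have h4 : opnorm (x *m (u - 1%:M)^t*) <= opnorm (u - 1%:M) * opnorm x.
  by rewrite mulrC; exact: (opnormM_le (lexx _) h1).
move: h3 h4; opnorm_lra.
Qed.

Definition conj_units u e i j := u *m e i j *m u^t*.

Lemma conj_unitsM u v e : conj_units v (conj_units u e) =2 conj_units (v *m u) e.
Proof. by move=> i j; rewrite /conj_units adjM !mulmxA. Qed.

Lemma conj_mul u x y : u \is unitarymx ->
  (u *m x *m u^t*) *m (u *m y *m u^t*) = u *m (x *m y) *m u^t*.
Proof.
move=> uU; rewrite -!mulmxA; congr (_ *m (_ *m _)).
by rewrite mulmxA (unitarymx_adjK uU) mul1mx.
Qed.

Lemma matrix_units_conj u e : u \is unitarymx -> matrix_units e ->
  matrix_units (conj_units u e).
Proof.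
move=> uU [eM eA e1]; split=> [i j k l|i j|].
- by rewrite /conj_units conj_mul // eM -scalemxAr -scalemxAl.
- by rewrite /conj_units !adjM trmxCK eA mulmxA.
by rewrite /conj_units -mulmx_suml -mulmx_sumr e1 mulmx1 unitarymxV.
Qed.

Lemma mxtrace_conj u x : u \is unitarymx -> \tr (u *m x *m u^t*) = \tr x.
Proof. by move=> uU; rewrite mxtrace_mulC mulmxA unitarymx_adjK // mul1mx. Qed.

Lemma conj_adjK u x : u \is unitarymx -> u *m (u^t* *m x *m u) *m u^t* = x.
Proof.
move=> uU; rewrite !mulmxA unitarymxV // mul1mx -mulmxA unitarymxV //.
by rewrite mulmx1.
Qed.

Lemma conj_adjKV u x : u \is unitarymx -> u^t* *m (u *m x *m u^t*) *m u = x.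
Proof.
move=> uU; rewrite !mulmxA unitarymx_adjK // mul1mx -mulmxA unitarymx_adjK //.
by rewrite mulmx1.
Qed.

Lemma condexp_conj u e x : u \is unitarymx ->
  condexp (conj_units u e) x = u *m condexp e (u^t* *m x *m u) *m u^t*.
Proof.
move=> uU; rewrite /condexp mulmx_sumr mulmx_suml; apply: eq_bigr => i _.
rewrite mulmx_sumr mulmx_suml; apply: eq_bigr => j _.
rewrite -scalemxAr -scalemxAl; congr (_ * _ *: _).
by rewrite /conj_units -{1}(conj_adjK x uU) conj_mul // mxtrace_conj.
Qed.

Lemma commexp_conj u e x : u \is unitarymx ->
  commexp (conj_units u e) x = u *m commexp e (u^t* *m x *m u) *m u^t*.
Proof.
move=> uU; rewrite /commexp -scalemxAr -scalemxAl; congr (_ *: _).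
rewrite mulmx_sumr mulmx_suml; apply: eq_bigr => i _.
rewrite mulmx_sumr mulmx_suml; apply: eq_bigr => j _.
by rewrite /conj_units -{1}(conj_adjK x uU) !conj_mul.
Qed.

Lemma avg_conj u e (T : 'M[C]_N -> 'M[C]_N) : u \is unitarymx ->
  avg (conj_units u e) T =
  u *m avg e (fun x => u^t* *m T (u *m x *m u^t*) *m u) *m u^t*.
Proof.
move=> uU; rewrite /avg -scalemxAr -scalemxAl; congr (_ *: _).
rewrite mulmx_sumr mulmx_suml; apply: eq_bigr => i _.
rewrite mulmx_sumr mulmx_suml; apply: eq_bigr => j _.
by rewrite /conj_units -conj_mul // conj_adjK.
Qed.

Lemma offdiag_conj u e x : u \is unitarymx ->
  offdiag (conj_units u e) x = u *m offdiag e (u^t* *m x *m u) *m u^t*.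
Proof.
move=> uU; rewrite /offdiag condexp_conj // commexp_conj //.
have -> : u^t* *m (x - u *m condexp e (u^t* *m x *m u) *m u^t*) *m u =
   u^t* *m x *m u - condexp e (u^t* *m x *m u).
  by rewrite mulmxBr mulmxBl conj_adjKV.
by rewrite mulmxBr mulmxBl [in RHS]mulmxBr [in RHS]mulmxBl conj_adjK.
Qed.

Lemma defect_conj u e (T : 'M[C]_N -> 'M[C]_N) : u \is unitarymx ->
  defect (conj_units u e) T =
  u *m defect e (fun x => u^t* *m T (u *m x *m u^t*) *m u) *m u^t*.
Proof.
move=> uU; rewrite /defect (offdiag_conj _ _ uU) (avg_conj _ _ uU).
by rewrite (conj_adjKV _ uU).
Qed.

Lemma inalg_conj u e x : u \is unitarymx ->
  inalg (conj_units u e) x -> inalg e (u^t* *m x *m u).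
Proof.
move=> uU; rewrite /inalg condexp_conj // => h.
by rewrite -{2}h conj_adjKV.
Qed.

Lemma skew_conj u x : skew (u *m x *m u^t*) = u *m skew x *m u^t*.
Proof.
rewrite /skew -scalemxAr -scalemxAl !adjM trmxCK mulmxBr mulmxBl.
by rewrite mulmxA.
Qed.

(** The inner and the outer conjugation are expanded separately. Of the 20, each expansion accounts
    for 4; the other 12 come from [commutator z] applied to [T (w - x)], which is of first order
    with constant 6. *)
Lemma superop_expansion u z x T (s : R) : u \is unitarymx -> z^t* = - z ->
  s <= 1 -> opnorm z <= s -> opnorm (u - 1%:M - z) <= s ^+ 2 ->
  (forall x, opnorm (T x) <= opnorm x) ->
  opnorm (u^t* *m T (u *m x *m u^t*) *m u -
    (T x + (T (commutator z x) - commutator z (T x)))) <= 20 * s ^+ 2 * opnorm x.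
Proof.
move=> uU zA s1 zs us Tc.
have s0 : 0 <= s by exact: le_trans (opnorm_ge0 z) zs.
set w := u *m x *m u^t*.
have hw : opnorm (w - x - commutator z x) <= 4 * s ^+ 2 * opnorm x.
  exact: conj_expansion.
have hw1 : opnorm w <= opnorm x by exact: opnorm_conj.
have hw2 : opnorm (w - x) <= 6 * s * opnorm x.
  have -> : w - x = (w - x - commutator z x) + commutator z x by rewrite subrK.
  apply: le_trans (opnormD _ _) _.
  have h1 := opnorm_commutator z x.
  have h2 : opnorm z * opnorm x <= s * opnorm x.
    by apply: ler_wpM2r zs; exact: opnorm_ge0.
  have h3 : s ^+ 2 * opnorm x <= s * opnorm x.
    by apply: ler_wpM2r; rewrite ?opnorm_ge0 // expr2 ler_piMr.
  by move: hw h1 h2 h3; opnorm_lra.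
have hT : opnorm (u^t* *m T w *m u - T w - commutator (- z) (T w)) <=
    4 * s ^+ 2 * opnorm (T w).
  have nA : (- z)^t* = - - z by rewrite adjN zA.
  have nN : opnorm (- z) <= s by rewrite opnormN.
  have nu : opnorm (u^t* - 1%:M - - z) <= s ^+ 2.
    have -> : u^t* - 1%:M - - z = (u - 1%:M - z)^t* by rewrite !adjB adj1 zA.
    exact: le_trans (opnorm_adj _) us.
  have := conj_expansion (T w) (unitary_adj uU) nA s1 nN nu.
  by rewrite trmxCK.
have -> : u^t* *m T w *m u - (T x + (T (commutator z x) - commutator z (T x))) =
   (u^t* *m T w *m u - T w - commutator (- z) (T w)) +
   T (w - x - commutator z x) - commutator z (T (w - x)).
  have -> : T (w - x - commutator z x) = T w - T x - T (commutator z x).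
    by rewrite !raddfB.
  have -> : commutator z (T (w - x)) = commutator z (T w) - commutator z (T x).
    by rewrite (raddfB T) (raddfB (commutator z)).
  rewrite /commutator; move: (T w) (T x) (T _) (u^t*) => a b c v; mx_ring.
have h1 : opnorm (T (w - x - commutator z x)) <= 4 * s ^+ 2 * opnorm x.
  exact: le_trans (Tc _) hw.
have h2 : opnorm (commutator z (T (w - x))) <= 12 * s ^+ 2 * opnorm x.
  apply: le_trans (opnorm_commutator _ _) _.
  have h3 : opnorm (T (w - x)) <= 6 * s * opnorm x by exact: le_trans (Tc _) hw2.
  have h4 := ler_pM (opnorm_ge0 z) (opnorm_ge0 _) zs h3.
  by move: h4; opnorm_lra.
have h5 : 4 * s ^+ 2 * opnorm (T w) <= 4 * s ^+ 2 * opnorm x.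
  apply: ler_wpM2l; last exact: le_trans (Tc _) hw1.
  by rewrite mulr_ge0 // exprn_ge0.
apply: le_trans (opnormB _ _) _; apply: le_trans (lerD (opnormD _ _) (lexx _)) _.
move: h1 h2 hT h5; opnorm_lra.
Qed.

Definition superop_conj u T : {linear 'M[C]_N -> 'M[C]_N} :=
  mulmxr u \o (mulmx (u^t*) \o (T \o (mulmxr (u^t*) \o mulmx u))).

(** The constant 20 of [superop_expansion] is doubled by [opnorm_sub_condexp] and again by
    [opnorm_defect]. *)
Lemma defect_expansion e u z T (s : R) : matrix_units e ->
  u \is unitarymx -> z^t* = - z ->
  s <= 1 -> opnorm z <= s -> opnorm (u - 1%:M - z) <= s ^+ 2 ->
  (forall x, opnorm (T x) <= opnorm x) ->
  opnorm (defect e (fun x => u^t* *m T (u *m x *m u^t*) *m u) - (defect e T +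
    defect e (fun x => T (commutator z x) - commutator z (T x)))) <= 80 * s ^+ 2.
Proof.
move=> eU uU zA s1 zs us Tc.
pose r : {linear 'M[C]_N -> 'M[C]_N} :=
  superop_conj u T \- (T \+ ((T \o commutator z) \- (commutator z \o T))).
have -> : defect e (fun x => u^t* *m T (u *m x *m u^t*) *m u) =
    defect e T + defect e (fun x => T (commutator z x) - commutator z (T x))
    + defect e r.
  rewrite -!defectD; apply: eq_defect => x.
  by rewrite /r /= addrC subrK.
rewrite addrAC subrr add0r.
have -> : 80 * s ^+ 2 = 2 * (40 * s ^+ 2) by ring.
apply: opnorm_defect => // [|x _]; first by rewrite mulr_ge0 // sqr_ge0.
apply: le_trans (opnorm_sub_condexp N_gt0 eU _) _.
have h : opnorm (r x) <= 20 * s ^+ 2 * opnorm x by exact: superop_expansion.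
by move: h; opnorm_lra.
Qed.

End Conjugation.

(** * Newton iteration *)

Section NewtonIteration.
Variables (R : realType) (N K : nat).
Hypothesis N_gt0 : (0 < N)%N.
Local Notation C := R[i].
Implicit Types (e : 'I_K.+1 -> 'I_K.+1 -> 'M[C]_N) (u v x y z : 'M[C]_N).
Implicit Types (S T : {linear 'M[C]_N -> 'M[C]_N}).

Lemma skew_subD x y z : skew (x - (y + z)) = skew x - (skew y + skew z).
Proof. by rewrite skewD skewN skewD. Qed.

(** Take the Cayley transform of [z = skew (defect e T)]. As [opnorm z <= 2 * k], the quadratic
    error is at most 160 k opnorm z, and the linearization adds 12 k opnorm z; the threshold 344 is
    twice the sum 172. The gain is a fixed factor and not quadratic, because the derivative is known
    only up to an error proportional to [k]. *)
Lemma newton_step e T (k : R) : matrix_units e -> 0 <= k -> k <= 344^-1 ->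
  almost_fixing e T k ->
  exists u, [/\ u \is unitarymx,
    opnorm (u - 1%:M) <= 2 * opnorm (skew (defect e T)) &
    opnorm (skew (defect (conj_units u e) T)) <= opnorm (skew (defect e T)) / 2].
Proof.
move=> eU k0 k1 aT; set (z := skew (defect e T)).
have zE : skew (defect e T) = z by [].
have zA : z^t* = - z by exact: skew_adj.
have hz : offdiag e z = z.
  by rewrite /z (offdiag_skew eU) (offdiag_defect N_gt0 eU).
have z2k : opnorm z <= 2 * k.
  apply: le_trans (opnorm_skew _) _; exact: opnorm_defect_self.
clearbody z; have k2 : 2 * k <= 1 by lra.
have z1 : opnorm z <= 1 by exact: le_trans z2k k2.
have [u uU hu] := cayley zA z1; exists u; split=> //.
  have -> : u - 1%:M = (u - 1%:M - z) + z by rewrite subrK.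
  apply: le_trans (opnormD _ _) _; have := opnorm_ge0 z.
  have : opnorm z ^+ 2 <= opnorm z by rewrite expr2 ler_piMr // opnorm_ge0.
  by move: hu; opnorm_lra.
rewrite defect_conj // skew_conj; apply: le_trans (opnorm_conj _ uU) _.
set d := defect e (fun x => _).
set l := defect e (fun x => T (commutator z x) - commutator z (T x)).
have hd : opnorm (d - (defect e T + l)) <= 80 * opnorm z ^+ 2.
  by case: aT => _ _; exact: (defect_expansion N_gt0 eU uU zA z1 (lexx _) hu).
have hl : opnorm (l + z) <= 12 * k * opnorm z by exact: defect_linearization.
clearbody d l.
have -> : skew d = skew (d - (defect e T + l)) + skew (l + z).
  have -> : skew (l + z) = z + skew l by rewrite (skewD l) (skew_id zA) addrC.
  have -> : skew (d - (defect e T + l)) = skew d - (z + skew l).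
    by rewrite -zE; exact: skew_subD.
  by rewrite subrK.
have h1 := opnorm_skew (d - (defect e T + l)).
have h2 := opnorm_skew (l + z).
have h3 : opnorm z * opnorm z <= 2 * k * opnorm z.
  by apply: ler_wpM2r; [exact: opnorm_ge0 | exact: z2k].
have h4 : k * opnorm z <= 344^-1 * opnorm z.
  by apply: ler_wpM2r; [exact: opnorm_ge0 | exact: k1].
apply: le_trans (opnormD _ _) _; move: hd hl h1 h2 h3 h4; rewrite expr2.
opnorm_lra.
Qed.

(** Step number j moves by at most 2 (2 k 2^-j), and these lengths sum to 8 k (1 - 2^-m). So every
    iterate stays within 8 k of the identity, where [T] is almost fixing with constant k + 4 (8 k) =
    33 k, below the threshold of [newton_step]. *)
Lemma newton_iteration e T (k : R) : matrix_units e -> 0 <= k ->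
  33 * k <= 344^-1 ->
  (forall u, u \is unitarymx ->
     almost_fixing (conj_units u e) T (k + 4 * opnorm (u - 1%:M))) ->
  forall m : nat, exists u, [/\ u \is unitarymx,
    opnorm (u - 1%:M) <= 8 * k * (1 - 2^-1 ^+ m) &
    opnorm (skew (defect (conj_units u e) T)) <= 2 * k * 2^-1 ^+ m].
Proof.
move=> eU k0 k1 aT; elim=> [|m [u [uU hu hd]]].
  have U1 : (1%:M : 'M[C]_N) \is unitarymx by apply/unitarymxP; rewrite adj1 mulmx1.
  have n1 : opnorm (1%:M - 1%:M : 'M[C]_N) = 0 by rewrite subrr opnorm0.
  exists 1%:M; split=> //; first by rewrite n1 expr0 subrr mulr0.
  apply: le_trans (opnorm_skew _) _; rewrite expr0 mulr1.
  apply: (opnorm_defect_self N_gt0 (matrix_units_conj U1 eU) k0).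
  by have := aT _ U1; rewrite n1 mulr0 addr0.
have p0 : 0 <= 2^-1 ^+ m :> R by rewrite exprn_ge0 // invr_ge0.
have p1 : 2^-1 ^+ m <= 1 :> R.
  by rewrite exprn_ile1 // ?invr_ge0 // invf_le1 // ler1n.
have hk : 8 * k * (1 - 2^-1 ^+ m) <= 8 * k.
  by apply: ler_piMr; [rewrite mulr_ge0 | rewrite gerBl].
have k'0 : 0 <= k + 4 * opnorm (u - 1%:M).
  by rewrite addr_ge0 // mulr_ge0 // opnorm_ge0.
have k'1 : k + 4 * opnorm (u - 1%:M) <= 344^-1.
  by move: hu hk k1; opnorm_lra.
have [v [vU hv hdv]] := newton_step (matrix_units_conj uU eU) k'0 k'1 (aT u uU).
have E : conj_units v (conj_units u e) = conj_units (v *m u) e.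
  by apply/funext => i; apply/funext => j; exact: conj_unitsM.
rewrite E in hdv.
exists (v *m u); split; [exact: mul_unitarymx vU uU | |].
  have -> : v *m u - 1%:M = (v - 1%:M) *m u + (u - 1%:M) by mx_ring.
  apply: le_trans (opnormD _ _) _.
  have h1 : opnorm ((v - 1%:M) *m u) <= opnorm (v - 1%:M).
    apply: le_trans (opnormM _ _) _; apply: ler_piMr; first exact: opnorm_ge0.
    exact: opnorm_unitary.
  have hv' := le_trans hv (ler_wpM2l (ler0n R 2) hd).
  move: h1 hu hv'; rewrite exprS; generalize (2^-1 ^+ m : R) => p; opnorm_lra.
apply: le_trans hdv _; rewrite ler_pdivrMr ?ltr0n //; apply: le_trans hd _.
by rewrite exprS; generalize (2^-1 ^+ m : R) => p; opnorm_lra.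
Qed.



End NewtonIteration.

(** * Exponentials of hermitian matrices *)

Section SpectralResolution.
Variables (R : realType) (N : nat).
Local Notation C := R[i].
Implicit Types (P : 'I_N -> 'M[C]_N) (f g : 'I_N -> C) (x w : 'M[C]_N) (t s : R).

Definition resolution P : Prop :=
  [/\ forall j k, P j *m P k = (j == k)%:R *: P j,
      \sum_j P j = 1%:M & forall j, (P j)^t* = P j].

Definition spec P f : 'M[C]_N := \sum_j f j *: P j.

Lemma herm_resolution H : H \is hermsymmx ->
  exists P, exists2 lam : 'I_N -> R, resolution P & H = spec P (fun j => (lam j)%:C).
Proof.
move=> hH; pose u := (spectralmx H)^t*.
have uU : u \is unitarymx by exact/unitary_adj/spectral_unitarymx.
have HE : H = u *m diag_mx (spectral_diag H) *m u^t*.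
  have /orthomx_spectralP {1}-> := hermitian_normalmx hH.
  by rewrite invmx_unitary ?spectral_unitarymx // /u trmxCK.
have hr := hermitian_spectral_diag_real hH.
exists (fun j => u *m delta_mx j j *m u^t*).
exists (fun j => complex.Re (spectral_diag H 0 j)).
  split=> [j k||j].
  - rewrite (conj_mul _ _ uU) mul_delta_mx_cond.
    have [<-|_] := eqVneq j k; first by rewrite mulr1n scale1r.
    by rewrite mulr0n mulmx0 mul0mx scale0r.
  - by rewrite -mulmx_suml -mulmx_sumr -mx1_sum_delta mulmx1 unitarymxV.
  by rewrite !adjM trmxCK trmx_delta map_delta_mx mulmxA.
rewrite {1}HE /spec diag_mx_sum_delta mulmx_sumr mulmx_suml; apply: eq_bigr => j _.
rewrite -scalemxAr -scalemxAl RRe_real //.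
by have /mxOverP := hr; apply.
Qed.

Section Fixed.
Variable P : 'I_N -> 'M[C]_N.
Hypothesis hP : resolution P.

Lemma specM f g : spec P f *m spec P g = spec P (fun j => f j * g j).
Proof.
case: hP => PM _ _; rewrite /spec mulmx_suml; apply: eq_bigr => j _.
rewrite mulmx_sumr (bigD1 j) //= big1 ?addr0 => [|k nk].
  by rewrite -scalemxAl -scalemxAr PM eqxx scale1r scalerA.
by rewrite -scalemxAl -scalemxAr PM eq_sym (negbTE nk) scale0r !scaler0.
Qed.

Lemma spec1 : spec P (fun=> 1) = 1%:M.
Proof. by case: hP => _ <- _; apply: eq_bigr => j _; rewrite scale1r. Qed.

Lemma specD f g : spec P f + spec P g = spec P (fun j => f j + g j).
Proof. by rewrite /spec -big_split; apply: eq_bigr => j _; rewrite scalerDl. Qed.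

Lemma specB f g : spec P f - spec P g = spec P (fun j => f j - g j).
Proof. by rewrite /spec -sumrB; apply: eq_bigr => j _; rewrite scalerBl. Qed.

Lemma specZ a f : a *: spec P f = spec P (fun j => a * f j).
Proof. by rewrite /spec scaler_sumr; apply: eq_bigr => j _; rewrite scalerA. Qed.

Lemma eq_spec f g : f =1 g -> spec P f = spec P g.
Proof. by move=> h; apply: eq_bigr => j _; rewrite h. Qed.

Lemma specX f k : spec P f ^+ k = spec P (fun j => f j ^+ k).
Proof.
elim: k => [|k IH]; first by rewrite expr0; exact/esym/spec1.
rewrite exprS IH; transitivity (spec P f *m spec P (fun j => f j ^+ k)) => //.
by rewrite specM; apply: eq_spec => j; rewrite exprS.
Qed.

Lemma spec_adj f : (spec P f)^t* = spec P (fun j => (f j)^*).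
Proof.
case: hP => _ _ PA; rewrite /spec raddf_sum /= raddf_sum.
by apply: eq_bigr => j _ /=; rewrite linearZ /= map_mxZ PA.
Qed.

Lemma mul_specP f j : spec P f *m P j = f j *: P j.
Proof.
case: hP => PM _ _; rewrite /spec mulmx_suml (bigD1 j) //= big1 ?addr0 => [|k nk].
  by rewrite -scalemxAl PM eqxx scale1r.
by rewrite -scalemxAl PM (negbTE nk) scale0r scaler0.
Qed.

Lemma mul_Pspec f j : P j *m spec P f = f j *: P j.
Proof.
case: hP => PM _ _; rewrite /spec mulmx_sumr (bigD1 j) //= big1 ?addr0 => [|k nk].
  by rewrite -scalemxAr PM eqxx scale1r.
by rewrite -scalemxAr PM eq_sym (negbTE nk) scale0r scaler0.
Qed.

Lemma resolution_blocks w : w = \sum_j \sum_k P j *m w *m P k.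
Proof.
case: hP => _ P1 _.
under eq_bigr do rewrite -mulmx_sumr P1 mulmx1.
by rewrite -mulmx_suml P1 mul1mx.
Qed.

Lemma opnorm_spec f : opnorm (spec P f) <= \sum_j Normc.normc (f j) * opnorm (P j).
Proof.
apply: le_trans (opnorm_sum _) _; apply: ler_sum => j _; exact: opnormZ.
Qed.

End Fixed.
End SpectralResolution.

(** * The unit circle: series and Taylor estimates *)

Section Cis.
Variable R : realType.
Local Notation C := R[i].
Implicit Types (t s x : R).

Definition cis t : C := cos t +i* sin t.

Lemma cisD s t : cis (s + t) = cis s * cis t.
Proof.
rewrite /cis cosD sinD; apply/eqP; rewrite eq_complex /= eqxx /=.
by rewrite addrC.
Qed.

Lemma cis0 : cis 0 = 1.
Proof. by rewrite /cis cos0 sin0. Qed.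

Lemma cisN t : cis (- t) = (cis t)^*.
Proof. by rewrite /cis cosN sinN. Qed.

Lemma cis_unit t : cis t * (cis t)^* = 1.
Proof. by rewrite -cisN -cisD subrr cis0. Qed.

(** Identifies the terms of the exponential series with those of the series defining [cos] and
    [sin], so that convergence is inherited from the latter. *)
Lemma exp_coeffE x k :
  (k`!%:R)^-1 * (0 +i* x) ^+ k = cos_coeff x k +i* sin_coeff x k :> C.
Proof.
have x2 : (0 +i* x) ^+ 2 = (- x ^+ 2)%:C :> C.
  by apply/eqP; rewrite expr2 eq_complex /= !mul0r mulr0 sub0r addr0 expr2 !eqxx.
have sqX m : (0 +i* x) ^+ m.*2 = ((-1) ^+ m * x ^+ m.*2)%:C :> C.
  rewrite -mul2n exprM x2 -rmorphXn /= exprM; congr (_ %:C).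
  by rewrite [LHS]exprNn.
have f0 : (k`!%:R : C)^-1 = (k`!%:R^-1 : R)%:C by rewrite fmorphV rmorph_nat.
rewrite {}f0 /cos_coeff /sin_coeff /=; move: (k`!%:R^-1) => a.
rewrite -(odd_double_half k); move: (odd k) (k./2) => [] m.
  rewrite add1n exprS sqX /= odd_double /= doubleK uphalf_double.
  by apply/eqP; rewrite eq_complex /= exprS -exprnP; apply/andP; split; apply/eqP; ring.
rewrite add0n sqX odd_double /= doubleK.
by apply/eqP; rewrite eq_complex /= -exprnP; apply/andP; split; apply/eqP; ring.
Qed.

Lemma normc_le (a b : R) : Normc.normc (a +i* b) <= `|a| + `|b|.
Proof.
have -> : a +i* b = a%:C + 'i * b%:C by rewrite [LHS]complexE.
apply: le_trans (le_normcD _ _) _.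
rewrite Normc.normcM /= !expr0n /= !add0r !addr0 expr1n sqrtr1 mul1r.
by rewrite !sqrtr_sqr.
Qed.

Lemma cvg_complex (a b : nat -> R) (la lb : R) :
  (a @ \oo --> la)%classic -> (b @ \oo --> lb)%classic ->
  ((fun n => (a n +i* b n : C^o)) @ \oo --> (la +i* lb : C^o))%classic.
Proof.
move=> ha hb; apply/cvgrPdist_lt => e e0.
have eE : e = (complex.Re e)%:C by rewrite RRe_real // gtr0_real.
rewrite eE ltcR in e0; have e2 : 0 < complex.Re e / 2 by rewrite divr_gt0.
near=> n.
rewrite eE [`|_|](_ : _ = (Normc.normc ((la - a n) +i* (lb - b n)))%:C) // ltcR.
apply: le_lt_trans (normc_le _ _) _; rewrite [ltRHS]splitr ltrD //.
  by near: n; move/cvgrPdist_lt : ha; apply.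
by near: n; move/cvgrPdist_lt : hb; apply.
Unshelve. all: by end_near. Qed.

Lemma abs_sin_le x : `|sin x| <= `|x|.
Proof.
wlog x0 : x / 0 <= x.
  move=> h; have [/h //|/ltW x0] := leP 0 x.
  by rewrite -normrN -sinN -[leRHS]normrN h // oppr_ge0.
have [z|c _] := @MVT_segment _ sin cos _ _ x0.
  exact/continuous_subspaceT/continuous_sin.
by rewrite sin0 !subr0 => ->; rewrite normrM ler_piMl // cos_max.
Qed.

Lemma abs_cos_sub1 x : `|cos x - 1| <= x ^+ 2 / 2.
Proof.
have xE : x = (x / 2) *+ 2 by rewrite -mulr_natr divfK.
rewrite {1}xE cos_mulr2n cos2sin2.
have -> : (1 - sin (x / 2) ^+ 2) *+ 2 - 1 - 1 = - (sin (x / 2) ^+ 2 *+ 2).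
  by rewrite mulr2n; ring.
rewrite normrN ger0_norm ?mulrn_wge0 ?sqr_ge0 // -mulr_natr.
have : sin (x / 2) ^+ 2 <= (x / 2) ^+ 2.
  by rewrite -[leLHS]real_normK ?num_real // -[leRHS]real_normK ?num_real //
    ler_pXn2r ?nnegrE // abs_sin_le.
rewrite expr_div_n; lra.
Qed.

Lemma abs_sin_subid x : `|sin x - x| <= x ^+ 2.
Proof.
wlog x0 : x / 0 <= x.
  move=> h; have [/h //|/ltW x0] := leP 0 x.
  by rewrite -normrN opprD -sinN -sqrrN h // oppr_ge0.
have [z|c /itvP cI] := @MVT_segment _ (fun y => sin y - y) (fun y => cos y - 1) _ _ x0.
  apply/continuous_subspaceT => y; apply: cvgB; [exact: continuous_sin|exact: cvg_id].
rewrite sin0 !subr0 => ->; rewrite normrM (ger0_norm x0).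
(* For x at most 2, [c <= x] gives [c ^+ 2 / 2 <= x]; beyond 2 the trivial bound [|cos c - 1| <= 2]
   suffices. *)
have [x2|x2] := leP x 2.
  rewrite expr2 ler_wpM2r //; apply: le_trans (abs_cos_sub1 _) _.
  have c0 : 0 <= c by rewrite cI.
  have cx : c <= x by rewrite cI.
  have : c * c <= x * 2 by rewrite ler_pM // (le_trans cx).
  rewrite expr2; lra.
rewrite expr2 ler_wpM2r //; apply: le_trans (ler_normB _ _) _.
by rewrite normr1; have := cos_max c; lra.
Qed.

Lemma cis_taylor x : Normc.normc (cis x - 1 - (0 +i* x)) <= 2 * x ^+ 2.
Proof.
have -> : cis x - 1 - (0 +i* x) = (cos x - 1) +i* (sin x - x).
  by apply/eqP; rewrite eq_complex /= !subr0 !eqxx.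
apply: le_trans (normc_le _ _) _.
by have := abs_cos_sub1 x; have := abs_sin_subid x; have := sqr_ge0 x; lra.
Qed.

End Cis.

(** * One-parameter unitary groups via the spectral resolution *)

Section Exponential.
Variables (R : realType) (N : nat).
Local Notation C := R[i].
Implicit Types (P : 'I_N -> 'M[C]_N) (x w : 'M[C]_N) (t s : R).

Section Fixed.
Variables (P : 'I_N -> 'M[C]_N) (lam : 'I_N -> R).
Hypothesis hP : resolution P.
Let H := spec P (fun j => (lam j)%:C).

Lemma cvg_spec (a : nat -> 'I_N -> C) (l : 'I_N -> C) :
  (forall j, ((fun n => (a n j : C^o)) @ \oo --> (l j : C^o))%classic) ->
  ((fun n => (spec P (a n) : 'M[C^o]_N)) @ \oo --> (spec P l : 'M[C^o]_N))%classic.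
Proof.
move=> h; rewrite /spec; elim: (index_enum _) => [|j r IH].
  rewrite big_nil; under eq_fun do rewrite big_nil; exact: cvg_cst.
rewrite big_cons; under eq_fun do rewrite big_cons.
apply: (@cvgD _ 'M[C^o]_N) IH.
exact: (@cvgZr_tmp _ 'M[C^o]_N _ _ _ _ _ (P j) (h j)).
Qed.

Lemma expmx_spec t : expmx (t *i *: H) = spec P (fun j => cis (t * lam j)).
Proof.
rewrite /expmx; apply: (@cvg_lim 'M[C^o]_N); first exact: norm_hausdorff.
have E : t *i *: H = spec P (fun j => 0 +i* (t * lam j)).
  rewrite /H (specZ P); apply: eq_spec => j.
  by apply/eqP; rewrite eq_complex /= !mul0r mulr0 subr0 add0r !eqxx.
pose a n j : C := series (cos_coeff (t * lam j)) n +i* series (sin_coeff (t * lam j)) n.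
rewrite [X in (X @ _)%classic](_ : _ = fun n => spec P (a n)); last first.
  apply/funext => n; rewrite /series /= E.
  rewrite /a /series /=; elim: n => [|n IH].
    rewrite big_geq // /spec big1 // => j _; rewrite !big_geq //.
    exact: scale0r.
  rewrite big_nat_recr //= IH (specX hP) (specZ P); apply: etrans (specD P _ _) _.
  by apply: eq_spec => j; rewrite !big_nat_recr //= exp_coeffE.
apply: cvg_spec => j; apply: cvg_complex.
  by rewrite cos.unlock; exact: is_cvg_series_cos_coeff.
by rewrite sin.unlock; exact: is_cvg_series_sin_coeff.
Qed.

End Fixed.

Lemma expmx_unitary (H : 'M[C]_N) t : H \is hermsymmx -> expmx (t *i *: H) \is unitarymx.
Proof.
move=> /herm_resolution[P [lam hP ->]]; rewrite (expmx_spec _ hP).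
apply/unitarymxP; rewrite (spec_adj hP) (specM hP) -(spec1 hP).
by apply: eq_spec => j; rewrite cis_unit.
Qed.

Lemma expmxN (H : 'M[C]_N) t : H \is hermsymmx ->
  expmx (- (t *i *: H)) = (expmx (t *i *: H))^t*.
Proof.
move=> /herm_resolution[P [lam hP ->]].
have -> (x : 'M[C]_N) : - (t *i *: x) = (- t) *i *: x.
  rewrite -scaleNr; congr (_ *: _).
  by apply/eqP; rewrite eq_complex /= oppr0 !eqxx.
rewrite !(expmx_spec _ hP) (spec_adj hP).
by apply: eq_spec => j; rewrite mulNr cisN.
Qed.

Lemma expmxD (H : 'M[C]_N) s t : H \is hermsymmx ->
  expmx ((s + t) *i *: H) = expmx (s *i *: H) *m expmx (t *i *: H).
Proof.
move=> /herm_resolution[P [lam hP ->]]; rewrite !(expmx_spec _ hP) (specM hP).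
by apply: eq_spec => j; rewrite mulrDl cisD.
Qed.

Lemma expmx0 (H : 'M[C]_N) : H \is hermsymmx -> expmx (0 *i *: H) = 1%:M.
Proof.
move=> /herm_resolution[P [lam hP ->]]; rewrite (expmx_spec _ hP) -(spec1 hP).
by apply: eq_spec => j; rewrite mul0r cis0.
Qed.

(** The constant depends on [H], which is harmless: it enters [almost_invariant_generator] only
    through the choice of the time step. *)
Lemma expmx_taylor (H : 'M[C]_N) : H \is hermsymmx -> exists2 c : R, 0 <= c &
  forall t, opnorm (expmx (t *i *: H) - 1%:M - t *i *: H) <= c * t ^+ 2.
Proof.
move=> /herm_resolution[P [lam hP ->]].
exists (\sum_j 2 * lam j ^+ 2 * opnorm (P j)) => [|t].
  apply: sumr_ge0 => j _; apply: mulr_ge0; last exact: opnorm_ge0.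
  by apply: mulr_ge0; [exact: ler0n | exact: sqr_ge0].
rewrite (expmx_spec _ hP) -(spec1 hP) (specZ P) !(specB P).
apply: le_trans (opnorm_spec _ _) _; rewrite mulr_suml; apply: ler_sum => j _.
have -> : t *i * (lam j)%:C = 0 +i* (t * lam j).
  by apply/eqP; rewrite eq_complex /= !mul0r mulr0 subr0 add0r !eqxx.
have := ler_wpM2r (opnorm_ge0 (P j)) (cis_taylor (t * lam j)).
by rewrite exprMn; congr (_ <= _); ring.
Qed.

(* [F] preserves the eigenspaces of [ad X], on which conjugation by
   [exp (itX)] is scalar. *)
Lemma expmx_conj_superop (X : 'M[C]_N) (F : {linear 'M[C]_N -> 'M[C]_N}) t x :
  X \is hermsymmx ->
  (forall y, F (X *m y - y *m X) = X *m F y - F y *m X) ->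
  F (expmx (t *i *: X) *m x *m (expmx (t *i *: X))^t*) =
  expmx (t *i *: X) *m F x *m (expmx (t *i *: X))^t*.
Proof.
move=> /herm_resolution[P [lam hP XE]] hF.
set V := expmx _.
have VE : V = spec P (fun j => cis (t * lam j)) by rewrite /V XE expmx_spec.
have VA : V^t* = spec P (fun j => cis (- (t * lam j))).
  by rewrite VE (spec_adj hP); apply: eq_spec => j; rewrite cisN.
have eig (mu : R) w : X *m w - w *m X = mu%:C *: w ->
    V *m w *m V^t* = cis (t * mu) *: w.
  move=> hw; rewrite {1}(resolution_blocks hP w) {2}(resolution_blocks hP w).
  rewrite mulmx_sumr mulmx_suml scaler_sumr; apply: eq_bigr => j _.
  rewrite mulmx_sumr mulmx_suml scaler_sumr; apply: eq_bigr => k _.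
  have -> : V *m (P j *m w *m P k) *m V^t* =
      cis (t * (lam j - lam k)) *: (P j *m w *m P k).
    rewrite VA VE !mulmxA (mul_specP hP) -!mulmxA (mul_Pspec hP).
    by rewrite -!scalemxAl -!scalemxAr scalerA -cisD mulrBr.
  have [<-//|ne] := eqVneq (lam j - lam k) mu.
  suff -> : P j *m w *m P k = 0 by rewrite !scaler0.
  (* Cutting the eigenvalue equation down to the block between [P j] and [P k] shows that the block
     vanishes unless its own eigenvalue [lam j - lam k] is [mu]. *)
  have h : (lam j - lam k)%:C *: (P j *m w *m P k) = mu%:C *: (P j *m w *m P k).
    rewrite [in RHS]scalemxAl [in RHS]scalemxAr -hw XE mulmxBr mulmxBl.
    rewrite !mulmxA (mul_Pspec hP) -[X in _ = _ - X]mulmxA (mul_specP hP).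
    by rewrite -!scalemxAl -!scalemxAr -scalerBl rmorphB.
  apply/eqP; move/eqP: h; rewrite -subr_eq0 -scalerBl scaler_eq0 -rmorphB.
  case/orP => // /eqP/(congr1 (@complex.Re R))/= /eqP.
  by rewrite subr_eq0 (negbTE ne).
have bl j k w : X *m (P j *m w *m P k) - (P j *m w *m P k) *m X =
    (lam j - lam k)%:C *: (P j *m w *m P k).
  rewrite XE !mulmxA (mul_specP hP) -[X in _ - X = _]mulmxA (mul_Pspec hP).
  by rewrite -!scalemxAl -!scalemxAr -scalerBl rmorphB.
rewrite {1}(resolution_blocks hP x) [in RHS](resolution_blocks hP x).
rewrite mulmx_sumr mulmx_suml !(raddf_sum F) mulmx_sumr mulmx_suml.
apply: eq_bigr => j _.
rewrite mulmx_sumr mulmx_suml !(raddf_sum F) mulmx_sumr mulmx_suml.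
apply: eq_bigr => k _.
rewrite (eig _ _ (bl j k x)); apply: etrans (linearZ_LR F _ _) _.
by rewrite (eig (lam j - lam k)) // -hF bl; exact: (linearZ_LR F).
Qed.

End Exponential.

(** * Averaged expectations and almost invariant algebras *)

Lemma telescope_ord (V : zmodType) (g : nat -> V) n :
  \sum_(k < n) (g k - g k.+1) = g 0%N - g n.
Proof.
elim: n => [|n IH]; first by rewrite big_ord0 subrr.
by rewrite big_ord_recr /= IH addrA subrK.
Qed.

Section AveragedExpectation.
Variables (R : realType) (N K : nat).
Hypothesis N_gt0 : (0 < N)%N.
Local Notation C := R[i].
Implicit Types (e : 'I_K.+1 -> 'I_K.+1 -> 'M[C]_N) (u v w x y z : 'M[C]_N).
Implicit Types (T : {linear 'M[C]_N -> 'M[C]_N}).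

(** Rotate [x] back to [x0] in the original algebra. Replacing [x] by [x0] costs
    [2 * opnorm (u - 1%:M)] twice, once inside the contraction [T] and once outside. *)
Lemma fixing_conj e T (k : R) u x : u \is unitarymx -> 0 <= k ->
  (forall y, inalg e y -> opnorm (T y - y) <= k * opnorm y) ->
  (forall y, opnorm (T y) <= opnorm y) -> inalg (conj_units u e) x ->
  opnorm (T x - x) <= (k + 4 * opnorm (u - 1%:M)) * opnorm x.
Proof.
move=> uU k0 Ta Tc hx; set x0 := u^t* *m x *m u.
have hx0 : inalg e x0 by exact: inalg_conj.
have x0x : opnorm (x0 - x) <= 2 * opnorm (u - 1%:M) * opnorm x.
  have := opnorm_conj_sub x (unitary_adj uU); rewrite trmxCK => h.
  apply: le_trans h _; apply: ler_wpM2r; first exact: opnorm_ge0.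
  apply: ler_wpM2l; first exact: ler0n.
  have -> : u^t* - 1%:M = (u - 1%:M)^t* by rewrite adjB adj1.
  exact: opnorm_adj.
have x0n : opnorm x0 <= opnorm x.
  by have := opnorm_conj x (unitary_adj uU); rewrite trmxCK.
have -> : T x - x = (T x0 - x0) - T (x0 - x) + (x0 - x).
  have -> : T (x0 - x) = T x0 - T x by rewrite raddfB.
  by move: (T x0) (T x) => a b; clearbody x0; mx_ring.
have h1 : opnorm (T x0 - x0) <= k * opnorm x.
  by apply: le_trans (Ta _ hx0) _; exact: ler_wpM2l.
have h2 := le_trans (Tc (x0 - x)) x0x.
apply: le_trans (opnormD _ _) _; apply: le_trans (lerD (opnormB _ _) (lexx _)) _.
move: h1 h2 x0x; opnorm_lra.
Qed.

Lemma almost_fixing_conj e T (k : R) u : matrix_units e -> u \is unitarymx ->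
  almost_fixing e T k -> 0 <= k ->
  almost_fixing (conj_units u e) T (k + 4 * opnorm (u - 1%:M)).
Proof.
move=> eU uU [Ta Tb Tc] k0; split=> // x; first exact: fixing_conj.
have Tbx := Tb x; move: (T x) (Tc x) Tbx => z zx zE.
rewrite condexp_conj //; set y := u^t* *m z *m u.
have yz : opnorm (z - y) <= 2 * opnorm (u - 1%:M) * opnorm x.
  have := opnorm_conj_sub z (unitary_adj uU); rewrite trmxCK -/y opnorm_subC => h.
  apply: le_trans h _; apply: ler_pM zx; [|exact: opnorm_ge0|].
    by apply: mulr_ge0; [exact: ler0n | exact: opnorm_ge0].
  apply: ler_wpM2l; first exact: ler0n.
  have -> : u^t* - 1%:M = (u - 1%:M)^t* by rewrite adjB adj1.
  exact: opnorm_adj.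
have h1 : opnorm (u *m condexp e (z - y) *m u^t*) <= 2 * opnorm (u - 1%:M) * opnorm x.
  apply: le_trans (opnorm_conj _ uU) _; apply: le_trans yz.
  exact: opnorm_condexp.
have h2 : opnorm (u *m condexp e z *m u^t* - condexp e z) <=
    2 * opnorm (u - 1%:M) * opnorm x.
  apply: le_trans (opnorm_conj_sub _ uU) _; apply: ler_wpM2l.
    by apply: mulr_ge0; [exact: ler0n | exact: opnorm_ge0].
  by apply: le_trans zx; exact: opnorm_condexp.
have -> : z - u *m condexp e y *m u^t* = (z - condexp e z) +
    u *m condexp e (z - y) *m u^t* - (u *m condexp e z *m u^t* - condexp e z).
  have -> : condexp e (z - y) = condexp e z - condexp e y by rewrite raddfB.
  rewrite mulmxBr mulmxBl; move: (u *m condexp e z *m u^t*) => a.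
  move: (u *m condexp e y *m u^t*) (condexp e z) => b c.
  mx_ring.
apply: le_trans (opnormB _ _) _; apply: le_trans (lerD (opnormD _ _) (lexx _)) _.
apply: le_trans (lerD (lerD zE h1) h2) _; opnorm_lra.
Qed.

Lemma inalg_conjV u e x : u \is unitarymx -> inalg e x ->
  inalg (conj_units u e) (u *m x *m u^t*).
Proof. by move=> uU hx; rewrite /inalg condexp_conj // conj_adjKV // hx. Qed.

Definition near_alg e w (d : R) := forall x, inalg e x ->
  exists2 y, inalg e y & opnorm (w *m x *m w^t* - y) <= d * opnorm x.

(** For every [y] in the algebra, x - E x = (x - y) - E (x - y); the expectation is thus, up to a
    factor 2, as good as any approximant. *)
Lemma near_alg_condexp e w (d : R) x : matrix_units e -> w \is unitarymx ->
  0 <= d -> near_alg e w d -> inalg (conj_units w e) x ->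
  opnorm (x - condexp e x) <= 2 * d * opnorm x.
Proof.
move=> eU wU d0 hw hx; have [y hy] := hw _ (inalg_conj wU hx).
rewrite (conj_adjK _ wU) => xy.
have -> : x - condexp e x = (x - y) - condexp e (x - y).
  have -> : condexp e (x - y) = condexp e x - y.
    by rewrite raddfB; congr (_ - _); exact: hy.
  by rewrite opprB addrA subrK.
apply: le_trans (opnorm_sub_condexp N_gt0 eU _) _.
rewrite -mulrA; apply: ler_wpM2l; first exact: ler0n.
apply: le_trans xy _; apply: (ler_wpM2l d0).
by have := opnorm_conj x (unitary_adj wU); rewrite trmxCK.
Qed.

(* Equality of dimensions turns one-sided nearness into two-sided nearness. *)
Lemma near_alg_sym e w (d : R) x : matrix_units e -> w \is unitarymx ->
  0 <= d -> d <= 4^-1 -> near_alg e w d -> inalg e x ->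
  opnorm (condexp (conj_units w e) x - x) <= 8 * d * opnorm x.
Proof.
move=> eU wU d0 d1; have d2 : 2 * d <= 2^-1 by lra.
move=> hw hx.
pose L : {linear 'M[C]_N -> 'M[C]_N} :=
  condexp e \o (mulmxr (w^t*) \o mulmx w).
pose f : 'End('M[C]_N) := linfun L.
pose U := limg (linfun (condexp e)).
have UP y : reflect (inalg e y) (y \in U).
  apply: (iffP idP) => [/memv_imgP[v _ ->]|hy].
    by rewrite lfunE; exact: inalg_condexp.
  by apply/memv_imgP; exists y; rewrite ?memvf // lfunE /= hy.
have h2 z : inalg e z -> opnorm (w *m z *m w^t* - L z) <= 2 * d * opnorm (w *m z *m w^t*).
  by move=> hz; exact: (near_alg_condexp eU wU d0 hw (inalg_conjV wU hz)).
(* [L] is injective on the algebra: if [L z = 0], then [w *m z *m w^t*] has norm at most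
   [2 * d <= 2^-1] times its own norm. *)
have kerU : (U :&: lker f = 0)%VS.
  apply/eqP; rewrite -subv0; apply/subvP => z; rewrite memv_cap memv0.
  case/andP => /UP hz; rewrite memv_ker lfunE => /eqP Lz.
  have := h2 _ hz; rewrite Lz subr0 => hn.
  have : opnorm (w *m z *m w^t*) = 0.
    apply: le_half_eq0; first exact: opnorm_ge0.
    apply: le_trans hn _; rewrite mulrC; apply: ler_wpM2l; first exact: opnorm_ge0.
    exact: d2.
  by move/opnorm_eq0 => h; rewrite -(conj_adjKV z wU) h mulmx0 mul0mx.
(* An injective linear map of a finite-dimensional space into itself is onto. So [x = L z], and the
   rotated [z] is an approximant of [x] in the rotated algebra. *)
have fU : (f @: U = U)%VS.
  apply/eqP; rewrite eqEdim limg_dim_eq // leqnn andbT.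
  apply/subvP => _ /memv_imgP[z _ ->]; apply/UP; rewrite lfunE.
  exact: inalg_condexp.
have : x \in (f @: U)%VS by rewrite fU; apply/UP.
case/memv_imgP => z /UP hz; rewrite lfunE => xE.
have hzL := h2 _ hz; rewrite -xE in hzL.
set y := w *m z *m w^t* in hzL.
have hy : inalg (conj_units w e) y by exact: inalg_conjV.
have y2 : opnorm y <= 2 * opnorm x.
  have : opnorm y <= opnorm (y - x) + opnorm x.
    by apply: le_trans (opnormD _ _); rewrite subrK.
  have : 2 * d * opnorm y <= 2^-1 * opnorm y.
    by apply: ler_wpM2r; [exact: opnorm_ge0 | exact: d2].
  by move: hzL; opnorm_lra.
(* The bound [2 * d * opnorm y] with [opnorm y <= 2 * opnorm x]; passing from [y] to the expectation
   doubles it to the 8 of the statement. *)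
have yx : opnorm (y - x) <= 4 * d * opnorm x.
  apply: le_trans hzL _; have := ler_wpM2l d0 y2; opnorm_lra.
have -> : condexp (conj_units w e) x - x =
    (y - x) - condexp (conj_units w e) (y - x).
  have -> : condexp (conj_units w e) (y - x) = y - condexp (conj_units w e) x.
    by rewrite raddfB; congr (_ - _); exact: hy.
  by rewrite opprB [RHS]addrC addrA subrK.
apply: le_trans (opnormB _ _) _.
have := opnorm_condexp N_gt0 (matrix_units_conj wU eU) (y - x).
by move: yx; opnorm_lra.
Qed.

Definition avg_condexp e (W : nat -> 'M[C]_N) (n : nat) x : 'M[C]_N :=
  (n%:R^-1 : R)%:C *: \sum_(k < n) condexp (conj_units (W k.+1) e) x.

Lemma avg_condexp_is_linear e W n : linear (avg_condexp e W n).
Proof.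
move=> a x y; rewrite /avg_condexp scalerA mulrC -scalerA -scalerDr; congr (_ *: _).
by rewrite scaler_sumr -big_split; apply: eq_bigr => k _; rewrite linearP.
Qed.
HB.instance Definition _ e W n :=
  GRing.isLinear.Build C 'M[C]_N 'M[C]_N _ (avg_condexp e W n)
    (avg_condexp_is_linear e W n).

Lemma opnorm_mean (n : nat) (F : 'I_n -> 'M[C]_N) (c : R) : (0 < n)%N ->
  (forall k, opnorm (F k) <= c) ->
  opnorm ((n%:R^-1 : R)%:C *: \sum_(k < n) F k) <= c.
Proof.
move=> n0 h; have nR : 0 < n%:R :> R by rewrite ltr0n.
have nV : 0 <= n%:R^-1 :> R by rewrite invr_ge0 ltW.
apply: le_trans (opnormZR _ nV) _; rewrite mulrC ler_pdivrMr //.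
apply: le_trans (opnorm_sum _) _.
apply: le_trans (ler_sum _ (fun k _ => h k)) _.
by rewrite sumr_const card_ord mulr_natr.
Qed.

Lemma mean_const (n : nat) x : (0 < n)%N ->
  (n%:R^-1 : R)%:C *: \sum_(k < n) x = x.
Proof.
move=> n0; rewrite sumr_const card_ord -[x *+ n]scaler_nat scalerA.
have -> : n%:R = (n%:R : R)%:C :> C by rewrite rmorph_nat.
by rewrite -rmorphM /= mulVf ?scale1r // pnatr_eq0 -lt0n.
Qed.

Lemma avg_condexp_almost_fixing e W (n : nat) (d : R) : matrix_units e ->
  (0 < n)%N -> 0 <= d -> d <= 4^-1 ->
  (forall k, W k \is unitarymx) ->
  (forall k, (k <= n)%N -> near_alg e (W k) d) ->
  almost_fixing e (avg_condexp e W n) (8 * d).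
Proof.
move=> eU n0 d0 d1 WU hW.
have cU k := matrix_units_conj (WU k) eU.
split=> [x hx|x|x].
- rewrite /avg_condexp -{2}(mean_const x n0) -scalerBr -sumrB.
  apply: opnorm_mean n0 _ => k.
  exact: (near_alg_sym eU (WU _) d0 d1 (hW _ (ltn_ord k)) hx).
- have -> : condexp e (avg_condexp e W n x) = (n%:R^-1 : R)%:C *:
      \sum_(k < n) condexp e (condexp (conj_units (W k.+1) e) x).
    rewrite /avg_condexp; apply: etrans (linearZ_LR (condexp e) _ _) _.
    by rewrite (raddf_sum (condexp e)).
  rewrite {1}/avg_condexp -scalerBr -sumrB.
  apply: opnorm_mean n0 _ => k.
  have hk := inalg_condexp N_gt0 (cU k.+1) x.
  apply: le_trans (near_alg_condexp eU (WU k.+1) d0 (hW _ (ltn_ord k)) hk) _.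
  have h := opnorm_condexp N_gt0 (cU k.+1) x.
  have := ler_wpM2l d0 h; have := mulr_ge0 d0 (opnorm_ge0 x); opnorm_lra.
by apply: opnorm_mean n0 _ => k; exact: opnorm_condexp.
Qed.

Lemma avg_condexp_shift e W (n : nat) x : (0 < n)%N ->
  (forall k, W k \is unitarymx) -> W 0%N = 1%:M ->
  (forall k, W k.+1 = W 1%N *m W k) ->
  (W 1%N)^t* *m avg_condexp e W n (W 1%N *m x *m (W 1%N)^t*) *m W 1%N -
    avg_condexp e W n x =
  (n%:R^-1 : R)%:C *: (condexp e x - condexp (conj_units (W n) e) x).
Proof.
move=> n0 WU W0 WS; set V := W 1%N; have VU := WU 1%N.
have E k : V^t* *m condexp (conj_units (W k.+1) e) (V *m x *m V^t*) *m V =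
    condexp (conj_units (W k) e) x.
  have -> : conj_units (W k.+1) e = conj_units V (conj_units (W k) e).
    apply/funext => i; apply/funext => j.
    by rewrite (conj_unitsM (W k) V e) -WS.
  by rewrite (condexp_conj _ _ VU) !(conj_adjKV _ VU).
rewrite /avg_condexp -scalemxAr -scalemxAl mulmx_sumr mulmx_suml -scalerBr.
congr (_ *: _).
transitivity (\sum_(k < n) condexp (conj_units (W k) e) x -
   \sum_(k < n) condexp (conj_units (W k.+1) e) x).
  by congr (_ - _); apply: eq_bigr => k _; exact: E.
rewrite -sumrB.
have e0 : condexp e x = condexp (conj_units (W 0%N) e) x.
  congr condexp; apply/funext => i; apply/funext => j.
  by rewrite /conj_units W0 adj1 mul1mx mulmx1.
rewrite e0; exact: (telescope_ord (fun k => condexp (conj_units (W k) e) x)).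
Qed.

End AveragedExpectation.

Lemma addl_sub (V : zmodType) (a b : V) : a + b - a = b.
Proof. by rewrite addrC addKr. Qed.

Lemma double_le_mul (F : realFieldType) (a b c d : F) :
  a * b <= 3 * c * d -> 2 * a * b <= 6 * c * d.
Proof. by lra. Qed.

(** * Bounding the off-diagonal part of the generator *)

Section AlmostInvariance.
Variables (R : realType) (N K : nat).
Hypothesis N_gt0 : (0 < N)%N.
Local Notation C := R[i].
Implicit Types (e : 'I_K.+1 -> 'I_K.+1 -> 'M[C]_N) (u w x y z : 'M[C]_N).
Implicit Types (T : {linear 'M[C]_N -> 'M[C]_N}).

(** Used with [x] the off-diagonal part zc of the generator, [y] the conjugated defect, [z] the
    defect of [T], [a] the first-order change due to zc and [b] the commutator of zg with the
    defect. The groups [a + x], [y - (z + (a - b))], [y - z] and, after [skew], [b] are each small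
    for a reason of its own. *)
Lemma telescoping_identity x y z (a b : 'M[C]_N) :
  x = a + x + (y - (z + (a - b)) - (y - z)) - b.
Proof. by mx_ring. Qed.

Lemma defect_commutatorD e T y z :
  defect e (fun x => T (commutator (y + z) x) - commutator (y + z) (T x)) =
  defect e (fun x => T (commutator y x) - commutator y (T x)) +
  defect e (fun x => T (commutator z x) - commutator z (T x)).
Proof.
rewrite -defectD; apply: eq_defect => x.
by rewrite !commutatorDl (raddfD T) opprD addrACA.
Qed.

(** Conjugation by [V] hardly changes [T], hence hardly changes its defect; to first order that
    change is about - zc, by [defect_linearization], minus the commutator of zg with the defect, by
    [defect_equivariant]. The bound on [r] makes the commutator at most [k * tau], so zc is small.
    The errors total 10 k tau, from 80 s^2, 8 k tau and k tau; the term 12 k opnorm zc is absorbed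
    on the left, with room to spare below 20. *)
Lemma opnorm_offdiag_generator e T V z (k s r tau : R) : matrix_units e ->
  V \is unitarymx -> z^t* = - z -> s <= 1 -> opnorm z <= s ->
  opnorm (V - 1%:M - z) <= s ^+ 2 ->
  0 <= k -> k <= 344^-1 -> 0 <= tau -> almost_fixing e T k ->
  (forall x, inalg e x ->
     opnorm (V^t* *m T (V *m x *m V^t*) *m V - T x) <= 2 * k * tau * opnorm x) ->
  opnorm (skew (defect e T)) <= r -> 6 * opnorm z * r <= k * tau ->
  80 * s ^+ 2 <= k * tau ->
  opnorm (offdiag e z) <= 20 * k * tau.
Proof.
move=> eU VU zA s1 zs Vs k0 k1 t0.
have kt0 : 0 <= 4 * (k * tau) by rewrite !mulr_ge0.
move=> aT hT hr hzr hs.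
set zc := offdiag e z; set zg := z - zc.
have zcA : zc^t* = - zc by rewrite /zc (offdiag_adj eU) zA raddfN.
have zgA : zg^t* = - zg by rewrite /zg adjB zA zcA opprK opprB addrC.
have zcK : offdiag e zc = zc by exact: offdiagK.
have zgE : zg = condexp e z + commexp e (z - condexp e z) by exact: offdiag_split.
have zgB : inalg e (condexp e z) by exact: inalg_condexp.
have zgC : incom e (commexp e (z - condexp e z)) by exact: commexp_com.
have zgn : opnorm zg <= 3 * opnorm z.
  rewrite zgE; apply: le_trans (opnormD _ _) _.
  apply: le_trans (lerD (opnorm_condexp N_gt0 eU _) (opnorm_commexp N_gt0 eU _)) _.
  apply: le_trans (lerD (lexx _) (opnorm_sub_condexp N_gt0 eU z)) _.
  by clear; opnorm_lra.
pose l y := defect e (fun x => T (commutator y x) - commutator y (T x)).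
set d := defect e (fun x => V^t* *m T (V *m x *m V^t*) *m V).
have Tc x : opnorm (T x) <= opnorm x by case: aT.
have hl : opnorm (d - (defect e T + l z)) <= 80 * s ^+ 2.
  exact: (defect_expansion N_gt0 eU VU zA s1 zs Vs Tc).
pose S : {linear 'M[C]_N -> 'M[C]_N} := superop_conj V T \- T.
have dE : d = defect e T + defect e S.
  by rewrite -defectD; apply: eq_defect => x; rewrite /= addrC subrK.
clearbody d.
have hd : opnorm (d - defect e T) <= 8 * (k * tau).
  have -> : d - defect e T = defect e S.
    by rewrite dE; exact: addl_sub.
  have -> : 8 * (k * tau) = 2 * (4 * (k * tau)) by ring.
  apply: (opnorm_defect N_gt0 eU); first exact: kt0.
  move=> x hx; apply: le_trans (opnorm_sub_condexp N_gt0 eU _) _.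
  have h : opnorm (S x) <= 2 * k * tau * opnorm x by exact: hT.
  by move: h; opnorm_lra.
have lz : l z = l zc + l zg.
  by rewrite -[z in LHS](subrK zc) addrC; exact: defect_commutatorD.
have lzg : l zg = - commutator zg (defect e T).
  exact: (defect_equivariant N_gt0 eU T zgE zgB zgC).
have lzc : opnorm (l zc + zc) <= 12 * k * opnorm zc.
  exact: (defect_linearization N_gt0 eU k0 aT zcK).
have zcE : zc = skew (l zc + zc) + (skew (d - (defect e T + l z)) -
    skew (d - defect e T)) - commutator zg (skew (defect e T)).
  rewrite -(skew_commutator _ zgA) -!skewN -!skewD -[LHS](skew_id zcA); congr skew.
  by rewrite lz lzg; exact: telescoping_identity.
have h1 := le_trans (opnorm_skew _) lzc.
have h2 := le_trans (opnorm_skew _) hl.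
have h3 := le_trans (opnorm_skew _) hd.
have h4 : opnorm (commutator zg (skew (defect e T))) <= k * tau.
  apply: le_trans (opnorm_commutator _ _) _; apply: le_trans hzr.
  have h := ler_pM (opnorm_ge0 _) (opnorm_ge0 _) zgn hr.
  exact: double_le_mul.
have h5 : k * opnorm zc <= 344^-1 * opnorm zc.
  by apply: ler_wpM2r k1; exact: opnorm_ge0.
have : opnorm zc <= 12 * k * opnorm zc + (80 * s ^+ 2 + 8 * (k * tau)) + k * tau.
  rewrite {1}zcE; apply: le_trans (opnormB _ _) _; apply: lerD h4.
  apply: le_trans (opnormD _ _) _; apply: lerD h1 _.
  by apply: le_trans (opnormB _ _) _; exact: lerD h2 h3.
have := opnorm_ge0 zc; move: h5 hs; generalize (opnorm zc) => o.
have -> : 20 * k * tau = 20 * (k * tau) by ring.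
by generalize (k * tau) (s ^+ 2) => p q; clear; lra.
Qed.

Lemma exists_exp2V_le (x y : R) : 0 < y -> exists m : nat, x * 2^-1 ^+ m <= y.
Proof.
move=> y0; exists (Num.bound (x / y)); set m := Num.bound _.
have h1 : x / y <= m%:R.
  have [x0|x0] := leP 0 (x / y); first exact/ltW/archi_boundP.
  by apply: le_trans (ltW x0) _.
have h2 : m%:R <= 2 ^+ m :> R by rewrite -natrX ler_nat ltnW // ltn_expl.
have p0 : 0 < 2 ^+ m :> R by rewrite exprn_gt0.
rewrite exprVn ler_pdivrMr // mulrC -ler_pdivrMr //; exact: le_trans h1 h2.
Qed.

Lemma herm_adj (H : 'M[C]_N) : H \is hermsymmx -> H^t* = H.
Proof. by move/is_hermitianmxP; rewrite expr0 scale1r => {2}->. Qed.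

Lemma adj_herm (H : 'M[C]_N) : H^t* = H -> H \is hermsymmx.
Proof. by move=> h; apply/is_hermitianmxP; rewrite expr0 scale1r h. Qed.

Lemma conj_imag (t : R) : (t *i : C)^* = - (t *i).
Proof. by apply/eqP; rewrite eq_complex /= oppr0 !eqxx. Qed.

Lemma normc_imag (t : R) : 0 <= t -> Normc.normc (t *i : C) = t.
Proof. by move=> t0; rewrite /= expr0n /= add0r sqrtr_sqr ger0_norm. Qed.

(** The second-order error is quadratic in the step and the allowance linear, so n at least 80 b^2 /
    k suffices. Adding [b] to this threshold secures the first inequality too. *)
Lemma exists_time_step (b k : R) : 1 <= b -> 0 < k ->
  exists n : nat, n.+1%:R^-1 * b <= 1 /\
    80 * (n.+1%:R^-1 * b) ^+ 2 <= k * n.+1%:R^-1.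
Proof.
move=> b1 k0; pose q := 80 * b ^+ 2 / k.
have b0 : 0 <= b by apply: le_trans b1.
have q0 : 0 <= q.
  by apply: divr_ge0; [apply: mulr_ge0; rewrite ?ler0n ?sqr_ge0 | exact: ltW].
exists (Num.bound (b + q)); set n := (Num.bound _).+1.
have nb : b + q <= n%:R.
  by apply/ltW/(lt_trans (archi_boundP (addr_ge0 b0 q0))); rewrite ltr_nat.
have nR : 0 < n%:R :> R by rewrite ltr0n.
split; first by rewrite ler_pdivrMl // mulr1; apply: le_trans nb; rewrite lerDl.
have -> : 80 * (n%:R^-1 * b) ^+ 2 = k * n%:R^-1 * (n%:R^-1 * q).
  by rewrite /q; field; rewrite !gt_eqF.
apply: ler_piMr; first by apply: mulr_ge0; rewrite ?invr_ge0 ltW.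
by rewrite ler_pdivrMl // mulr1; apply: le_trans nb; rewrite lerDr.
Qed.

(** The mean [T] is almost fixing with constant 8 d; the iteration moves the algebra by at most 8 (8
    d) = 64 d, which raises the constant to 8 d + 4 (64 d) = 264 d. Hence the requirement
    [264 * d <= k]. *)
Lemma almost_invariant_generator e (H : 'M[C]_N) (d k : R) : matrix_units e ->
  H \is hermsymmx -> 0 < d -> 264 * d <= k -> k <= 344^-1 ->
  (forall t, 0 <= t <= 1 -> near_alg e (expmx (t *i *: H)) d) ->
  exists u, [/\ u \is unitarymx, opnorm (u - 1%:M) <= k &
    opnorm (offdiag (conj_units u e) H) <= 20 * k].
Proof.
move=> eU hH d0 dk k1.
have k0 : 0 < k by lra.
have d4 : d <= 4^-1 by lra.
have d8 : 0 <= 8 * d by lra.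
have h33 : 33 * (8 * d) <= 344^-1 by lra.
move=> hB.
have [c c0 tay] := expmx_taylor hH.
(* A single size for [opnorm H] and, through [c <= b <= b ^+ 2], for the Taylor constant; the
   summand 1 ensures [b <= b ^+ 2]. *)
pose b := 1 + opnorm H + c.
have oH := opnorm_ge0 H.
have b1 : 1 <= b by rewrite /b -addrA lerDl addr_ge0.
have Hb : opnorm H <= b by rewrite /b addrAC lerDr addr_ge0.
have cb : c <= b ^+ 2.
  apply: le_trans (_ : b <= _); first by rewrite /b lerDr addr_ge0.
  by rewrite expr2 ler_peMr // (le_trans ler01).
have [n' [s1 ss]] := exists_time_step b1 k0.
pose n := n'.+1; have nR : 0 < n%:R :> R by rewrite ltr0n.
pose tau : R := n%:R^-1; have t0 : 0 < tau by rewrite invr_gt0.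
pose s := tau * b; rewrite -/n -/tau -/s in s1 ss.
pose z : 'M[C]_N := tau *i *: H.
have zA : z^t* = - z by rewrite /z adjZ herm_adj // conj_imag scaleNr.
have zn : opnorm z <= s.
  apply: le_trans (opnormZ _ _) _; rewrite (normc_imag (ltW t0)).
  exact: (ler_wpM2l (ltW t0)).
pose W (j : nat) := expmx ((tau * j%:R) *i *: H).
have WU j : W j \is unitarymx by exact: expmx_unitary.
have W0 : W 0%N = 1%:M by rewrite /W mulr0 expmx0.
have W1E : W 1%N = expmx (tau *i *: H) by rewrite /W mulr1.
have WS j : W j.+1 = W 1%N *m W j.
  have tS : tau * j.+1%:R = tau + tau * j%:R by rewrite -natr1 mulrDr mulr1 addrC.
  by rewrite W1E /W tS; exact: expmxD.
have hW j : (j <= n)%N -> near_alg e (W j) d.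
  move=> jn; apply: (hB); apply/andP; split.
    by apply: mulr_ge0; [exact: ltW | exact: ler0n].
  by rewrite (ler_pdivrMl _ _ nR) mulr1 ler_nat.
have Vs : opnorm (W 1%N - 1%:M - z) <= s ^+ 2.
  rewrite W1E; apply: le_trans (tay tau) _.
  by rewrite /s exprMn mulrC; apply: ler_wpM2l cb; exact: sqr_ge0.
pose T : {linear 'M[C]_N -> 'M[C]_N} := avg_condexp e W n.
have aT : almost_fixing e T (8 * d).
  exact: (avg_condexp_almost_fixing N_gt0 eU (ltn0Sn _) (ltW d0) d4 WU hW).
have aTu u (uU : u \is unitarymx) := almost_fixing_conj N_gt0 eU uU aT d8.
(* The number of Newton steps depends on [H] and on the time step; the bound on [u - 1%:M] does
   not. *)
have [m hm] := @exists_exp2V_le (6 * opnorm z * (2 * (8 * d))) (k * tau)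
  (mulr_gt0 k0 t0).
have [u [uU hu hd]] := newton_iteration N_gt0 eU d8 h33 aTu m.
have p0 : 0 <= 2^-1 ^+ m :> R by rewrite exprn_ge0.
have hu' : opnorm (u - 1%:M) <= 8 * (8 * d).
  by apply: le_trans hu _; apply: ler_piMr; [exact: mulr_ge0 | rewrite gerBl].
exists u; split; [exact: uU | by apply: le_trans hu' _; clear -dk d0; lra |].
have eUu := matrix_units_conj uU eU.
have hk : 8 * d + 4 * opnorm (u - 1%:M) <= k.
  by move: hu'; clear -dk d0; opnorm_lra.
have aTk : almost_fixing (conj_units u e) T k.
  have [Ta Tb Tc] := aTu u uU.
  split; [move=> x | move=> x | exact: Tc].
    move=> hx; apply: le_trans (Ta x hx) _; apply: ler_wpM2r hk; exact: opnorm_ge0.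
  apply: le_trans (Tb x) _; apply: ler_wpM2r hk; exact: opnorm_ge0.
have hT x : inalg (conj_units u e) x ->
    opnorm ((W 1%N)^t* *m T (W 1%N *m x *m (W 1%N)^t*) *m W 1%N - T x) <=
    2 * k * tau * opnorm x.
  move=> hx.
  have -> : (W 1%N)^t* *m T (W 1%N *m x *m (W 1%N)^t*) *m W 1%N - T x =
      tau%:C *: (condexp e x - condexp (conj_units (W n) e) x).
    exact: (avg_condexp_shift e x (ltn0Sn n') WU W0 WS).
  apply: le_trans (opnormZR _ (ltW t0)) _.
  have E0 : opnorm (condexp e x - x) <= k * opnorm x.
    apply: le_trans (fixing_conj uU d8 _ _ hx) _.
    - move=> y hy; have y0 : opnorm (condexp e y - y) = 0 by rewrite hy subrr opnorm0.
      by rewrite [leLHS]y0; apply: mulr_ge0 d8 (opnorm_ge0 _).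
    - exact: opnorm_condexp.
    by apply: ler_wpM2r hk; exact: opnorm_ge0.
  have En : opnorm (condexp (conj_units (W n) e) x - x) <= k * opnorm x.
    apply: le_trans (fixing_conj uU d8 _ _ hx) _.
    - by move=> y; exact: (near_alg_sym N_gt0 eU (WU n) (ltW d0) d4 (hW n (leqnn n))).
    - by move=> y; exact: (opnorm_condexp N_gt0 (matrix_units_conj (WU n) eU) y).
    by apply: ler_wpM2r hk; exact: opnorm_ge0.
  (* The two ends of the telescoped sum are expectations that both nearly fix the rotated algebra;
     comparing each with [x] gives k twice. *)
  have -> : condexp e x - condexp (conj_units (W n) e) x =
      (condexp e x - x) - (condexp (conj_units (W n) e) x - x).
    by rewrite opprB addrA subrK.
  have h := le_trans (opnormB _ _) (lerD E0 En).
  have -> : 2 * k * tau * opnorm x = tau * (k * opnorm x + k * opnorm x) by ring.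
  exact: (ler_wpM2l (ltW t0) h).
have hzr : 6 * opnorm z * (2 * (8 * d) * 2^-1 ^+ m) <= k * tau by rewrite mulrA.
have hz := opnorm_offdiag_generator eUu (WU 1%N) zA s1 zn Vs (ltW k0) k1
  (ltW t0) aTk hT hd hzr ss.
(* The factor -ni undoes the passage from [H] to [z]; its modulus [n] cancels the [tau] in the bound
   on [offdiag]. *)
have ntau : n%:R * tau = 1 by exact: mulfV (lt0r_neq0 nR).
have one : ((- n%:R : R) *i : C) * tau *i = 1.
  by apply/eqP; rewrite eq_complex /= !mul0r mulr0 addr0 sub0r mulNr opprK ntau !eqxx.
have HE : H = ((- n%:R : R) *i : C) *: z by rewrite /z scalerA one scale1r.
have -> : offdiag (conj_units u e) H =
    ((- n%:R : R) *i : C) *: offdiag (conj_units u e) z.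
  by rewrite {1}HE; exact: (linearZ_LR (offdiag (conj_units u e))).
apply: le_trans (opnormZ _ _) _.
have -> : Normc.normc ((- n%:R : R) *i : C) = n%:R.
  by rewrite /= expr0n /= add0r sqrrN sqrtr_sqr ger0_norm // ltW.
have -> : 20 * k = n%:R * (20 * k * tau).
  by rewrite mulrCA ntau mulr1.
by apply: ler_wpM2l hz; exact: ltW.
Qed.

End AlmostInvariance.

(** * Matrix units of the given subalgebra and the conclusion *)

Lemma mulmx_sandwichK (F : pzRingType) (n : nat) (g h x : 'M[F]_n) :
  g *m h = 1%:M -> g *m (h *m x *m g) *m h = x.
Proof. by move=> gh; rewrite !mulmxA gh mul1mx -mulmxA gh mulmx1. Qed.

Lemma matrix_units_of_star_iso (R : realType) (N K : nat)
    (B : set 'M[R[i]]_N) (phi : 'M[R[i]]_K.+1 -> 'M[R[i]]_N) :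
  (0 < N)%N -> unital_star_subalgebra B -> linear phi ->
  {morph phi : a b / a *m b} -> {morph phi : a / a^t*} ->
  set_bij [set: 'M[R[i]]_K.+1] B phi ->
  let e i j := phi (delta_mx i j) in
  matrix_units e /\ forall x, B x <-> inalg e x.
Proof.
move=> N0 [B1 BD BZ BM BA] lphi phiM phiA [phiB phiI phiS] e.
pose Phi : {linear 'M[R[i]]_K.+1 -> 'M[R[i]]_N} :=
  HB.pack phi (GRing.isLinear.Build _ _ _ _ phi lphi).
have PhiE a : phi a = Phi a by [].
(* [phi] is not given as unital. But the identity lies in its image, on which [phi 1%:M] acts as a
   unit. *)
have phi1 : phi 1%:M = 1%:M.
  have [a _ aE] := phiS _ B1.
  by rewrite -[LHS]mulmx1 -aE -phiM mul1mx.
have eU : matrix_units e.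
  split=> [i j k l|i j|].
  - rewrite /e -phiM mul_delta_mx_cond.
    have [_|_] := eqVneq j k; first by rewrite mulr1n scale1r.
    by rewrite mulr0n scale0r PhiE raddf0.
  - by rewrite /e -phiA trmx_delta map_delta_mx.
  by rewrite -phi1 mx1_sum_delta PhiE raddf_sum.
split=> // x; split=> [Bx|<-].
  have [a _ <-] := phiS _ Bx.
  rewrite (matrix_sum_delta a) PhiE raddf_sum; apply: inalg_sum => i.
  rewrite raddf_sum; apply: inalg_sum => j.
  change (inalg e (phi (a i j *: delta_mx i j))).
  have -> : phi (a i j *: delta_mx i j) = a i j *: e i j by exact: (linearZ_LR Phi).
  by apply: inalgZ; exact: (inalg_unit N0 eU).
have B0 : B 0 by rewrite -(scale0r 1%:M); exact: BZ.
rewrite /condexp; elim/big_ind: _ => // i _; elim/big_ind: _ => // j _.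
by apply: BZ; exact: phiB.
Qed.

Theorem proposition1p5 (R : realType) (eps : R) (eps_gt0 : 0 < eps) :
  exists2 delta : R, 0 < delta &
  forall (N K : nat) (B : set 'M[R[i]]_N) (H : 'M[R[i]]_N),
    (0 < N)%N -> (K %| N)%N ->
    unital_star_subalgebra B ->
    star_isomorphic_to_mx K B ->
    H \is hermsymmx ->
    (forall t : R, 0 <= t <= 1 ->
       near_subset delta
         (sandwich (expmx (t *i *: H)) B (expmx (- (t *i *: H)))) B) ->
  exists u h : 'M[R[i]]_N,
    [/\ u \is unitarymx, h \is hermsymmx,
        opnorm (u - 1%:M) < eps, opnorm h < eps
      & forall t : R,
          sandwich (u ^t* *m expmx (t *i *: (H + h)) *m u) B
                   (u ^t* *m expmx (- (t *i *: (H + h))) *m u) = B].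
Proof.
(* The first entry is the Newton threshold; the second makes [20 * k], the bound on [h], at most
   [eps / 2]. *)
pose k := Num.min 344^-1 (eps / 40).
have k0 : 0 < k by rewrite lt_min invr_gt0 ltr0n divr_gt0.
have k1 : k <= 344^-1 by rewrite ge_min lexx.
have k2 : k <= eps / 40 by rewrite ge_min lexx orbT.
have keps : k < eps by clear -k0 k2; lra.
have k20 : 20 * k < eps by clear -k0 k2; lra.
have d0 : 0 < k / 264 by apply: divr_gt0; [exact: k0 | rewrite ltr0n].
exists (k / 264); first exact: d0.
move=> N K B H N0 KN hB [phi [lphi phiM phiA phiB]] hH hnear.
(* Matrix units are indexed by a successor. For [K = 0] divisibility would force [N = 0]. *)
case: K KN phi lphi phiM phiA phiB => [|K] KN phi lphi phiM phiA phiB.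
  by exfalso; move: N0; rewrite lt0n -dvd0n KN.
have := matrix_units_of_star_iso N0 hB lphi phiM phiA phiB.
set e := (fun i j => _) => -[eU BE].
have near t : 0 <= t <= 1 -> near_alg e (expmx (t *i *: H)) (k / 264).
  move=> ht x hx; set V := expmx (t *i *: H).
  have VU : V \is unitarymx by exact: expmx_unitary.
  have [|y By xy] := hnear t ht (V *m x *m V^t*).
    by exists x; [exact/BE | rewrite expmxN].
  exists y; first exact/BE.
  apply: le_trans xy _; apply: ler_wpM2l; first exact: ltW.
  exact: opnorm_conj.
have dk : 264 * (k / 264) <= k by rewrite mulrC divfK // pnatr_eq0.
have [u [uU hu hoff]] := almost_invariant_generator N0 eU hH d0 dk k1 near.
set e' := conj_units u e in hoff.
have eU' : matrix_units e' by exact: matrix_units_conj.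
pose h := - offdiag e' H; pose X := H + h.
have hA : h^t* = h by rewrite /h adjN (offdiag_adj eU') (herm_adj hH).
have XA : X \is hermsymmx by apply: adj_herm; rewrite /X adjD hA (herm_adj hH).
have XE : X = condexp e' H + commexp e' (H - condexp e' H).
  by rewrite /X /h; exact: offdiag_split.
(* [X] is in the algebra plus its commutant, so its commutator respects the expectation. Conjugation
   by the group of [X] then does too, and hence preserves the fixed points of the expectation, which
   form the algebra. *)
have Xc y : condexp e' (X *m y - y *m X) = X *m condexp e' y - condexp e' y *m X.
  rewrite -!commutatorE; apply: (condexp_commutator N0 eU' y XE).
    exact: inalg_condexp.
  exact: commexp_com.
have inv t b : B b -> B ((u^t* *m expmx (t *i *: X) *m u) *m b *m
    (u^t* *m expmx (- (t *i *: X)) *m u)).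
  move=> /BE hb; rewrite (expmxN t XA); set V := expmx _; apply/BE.
  have -> : (u^t* *m V *m u) *m b *m (u^t* *m V^t* *m u) =
     u^t* *m (V *m (u *m b *m u^t*) *m V^t*) *m u by rewrite !mulmxA.
  apply: (inalg_conj uU); rewrite /inalg /V.
  rewrite (@expmx_conj_superop _ _ X (condexp e') t _ XA Xc).
  by congr (_ *m _ *m _); exact: (inalg_conjV uU hb).
exists u, h; split=> //.
- exact: adj_herm.
- exact: le_lt_trans hu keps.
- by rewrite /h opnormN; exact: le_lt_trans hoff k20.
(* [inv] gives one inclusion for every real time. The other follows from [inv] at [- t], which
   supplies a preimage of [b] inside [B]. *)
move=> t; rewrite -/X; apply/seteqP; split=> [_ [b Bb <-]|b Bb]; first exact: inv.
have tN : (- t) *i *: X = - (t *i *: X).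
  by rewrite -scaleNr; congr (_ *: _); apply/eqP; rewrite eq_complex /= oppr0 !eqxx.
have := inv (- t) b Bb; rewrite tN opprK (expmxN t XA).
set V := expmx _ => Bc; have VU : V \is unitarymx by exact: expmx_unitary.
exists ((u^t* *m V^t* *m u) *m b *m (u^t* *m V *m u)) => //.
rewrite -/V; move: (u^t*) (V^t*) (unitarymxV uU) (unitarymx_adjK uU) (unitarymxV VU).
move=> u' V' uu' u'u VV'.
have g1 : (u' *m V *m u) *m (u' *m V' *m u) = 1%:M.
  rewrite !mulmxA -(mulmxA (u' *m V)) uu' mulmx1 -(mulmxA u') VV' mulmx1.
  exact: u'u.
exact: mulmx_sandwichK.
Qed.
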